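(* Let $(X,|\cdot|_X)$ and $(Y,|\cdot|_Y)$ be real Banach spaces and let $f:X\to Y$ be a local $C^1$-diffeomorphism. Let $h:[0,+\infty)\to[0,+\infty)$ be a continuous nondecreasing function such that $\int_0^\infty\frac{1}{1+h(\rho)}\,d\rho=+\infty$. Suppose that for every $y\in Y$ the functional $F_y:X\to\mathbb{R}$, $F_y(x)=\frac12|f(x)-y|_Y^2$, satisfies the weighted Chang Palais-Smale condition for $h$. Then $f$ is a norm-coercive global $C^1$-diffeomorphism onto $Y$; that is, $f$ is bijective, its inverse is $C^1$, and $\lim_{|x|_X\to+\infty}|f(x)|_Y=+\infty$.
   Context: A map $f:X\to Y$ is a local $C^1$-diffeomorphism if it is $C^1$ and $df(x)$ is a linear isomorphism of $X$ onto $Y$ for every $x\in X$. For a locally Lipschitz functional $F:X\to\mathbb{R}$ on a real Banach space $X$ with dual $X^*$, the generalized directional derivative is $F^0(x;v)=\limsup_{z\to 0,\ t\downarrow 0}\frac1t\left(F(x+z+tv)-F(x+z)\right)$, the Clarke generalized gradient is $\partial F(x)=\{w^*\in X^*: \langle w^*,v\rangle\le F^0(x;v)\ \forall v\in X\}$ (a nonempty convex weak*-compact set), and $\lambda_F(x)=\min_{w^*\in\partial F(x)}|w^*|_{X^*}$. Given $h$, the functional $F$ satisfies the weighted Chang Palais-Smale condition for $h$ if any sequence $\{x_n\}$ in $X$ such that $\{F(x_n)\}$ is bounded and $\lim_{n\to\infty}\lambda_F(x_n)(1+h(|x_n|_X))=0$ contains a norm-convergent subsequence. *)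

(* Defs.v *)
From HB Require Import structures.
From mathcomp Require Import all_boot all_order all_algebra.
From mathcomp Require Import all_classical all_reals all_analysis.

Set Implicit Arguments.
Unset Strict Implicit.
Unset Printing Implicit Defensive.

Import Order.TTheory GRing.Theory Num.Theory.
Import numFieldNormedType.Exports.

Local Open Scope classical_set_scope.
Local Open Scope ring_scope.

Section C1_maps.
Context {R : realType}.

(* Stated for plain functions, so that it applies to a difference of two
   differentials; it is the operator norm when g is linear and continuous
   ([sup] of an unbounded set is 0, so it is used only for such g). *)
Definition opnorm {V W : normedModType R} (g : V -> W) : R :=
  sup [set `|g v| | v in [set v : V | `|v| <= 1]].

(* [differentiable] is Frechet differentiability, with a continuous
   differential; the second clause is continuity of x |-> 'd f x for the
   operator norm. *)
Definition C1_map {V W : normedModType R} (f : V -> W) : Prop :=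
  (forall x, differentiable f x) /\
  (forall x0, opnorm (fun v => 'd f x v - 'd f x0 v) @[x --> x0] --> (0 : R)).

Definition local_C1_diffeo {V W : normedModType R} (f : V -> W) : Prop :=
  C1_map f /\ forall x, bijective ('d f x).

Definition global_C1_diffeo {V W : normedModType R} (f : V -> W) : Prop :=
  C1_map f /\ exists g : W -> V, [/\ cancel f g, cancel g f & C1_map g].

Definition norm_coercive {V W : normedModType R} (f : V -> W) : Prop :=
  forall M : R, exists r : R, forall x, r < `|x| -> M < `|f x|.

End C1_maps.

(* These notions are meant for locally Lipschitz F. *)
Section Clarke.
Context {R : realType} {X : normedModType R}.
Implicit Types (F : X -> R) (x v : X).

Definition clarke_dirderiv F x v : \bar R :=
  limf_esup (fun p : X * R => (p.2^-1 * (F (x + p.1 + p.2 *: v) - F (x + p.1)))%:E)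
    (filter_prod (nbhs (0 : X)) (0 : R)^'+).

Definition clarke_gradient F x : set {linear X -> R^o} :=
  [set w : {linear X -> R^o} |
    continuous w /\ forall v, ((w v : R)%:E <= clarke_dirderiv F x v)%E].

(* For F locally Lipschitz the gradient is nonempty and weak* compact, so this
   infimum is a minimum. *)
Definition clarke_lambda F x : R :=
  inf [set opnorm w | w in clarke_gradient F x].

Definition weighted_chang_PS (h : R -> R) F : Prop :=
  forall u : nat -> X,
    (exists M : R, forall n, `|F (u n)| <= M) ->
    clarke_lambda F (u n) * (1 + h `|u n|) @[n --> \oo] --> (0 : R) ->
    exists2 phi : nat -> nat,
      {homo phi : m n / (m < n)%N} & cvgn (u \o phi).

End Clarke.

(* Main.v *)
Require Import Defs.
From HB Require Import structures.
From mathcomp Require Import all_boot all_order all_algebra.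
From mathcomp Require Import all_classical all_reals all_analysis.
From mathcomp Require Import measurable_realfun ring lra.

Import Order.TTheory GRing.Theory Num.Theory.
Import numFieldNormedType.Exports.

Local Open Scope classical_set_scope.
Local Open Scope ring_scope.

(* Properness plus path lifting.  If a point z almost minimizes F in the sense
   F >= F z - k |. - z| near z, then Hahn-Banach yields a Clarke subgradient of
   norm at most k at z.  Let H be the primitive of 1/(1+h).  Were F_y not
   coercive, Ekeland's principle applied to F_y + e |H |.| - H |x0||, with F_y
   bounded at a far away point x0, would produce points going to infinity along
   which F_y is bounded and lambda (1+h) tends to 0, since H is unbounded and
   has local Lipschitz constant about 1/(1+h |z|) at z.  So each F_y is
   coercive, h is bounded where F_y is, and Ekeland's principle for F_y near
   points x_n with f x_n --> y turns the Palais-Smale condition for F_y into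
   properness: (x_n) has a convergent subsequence.
   A proper local homeomorphism f has, on a maximal open set which is
   star-shaped about f a, a continuous section sending f a to a.  Properness
   makes this set the whole space, and uniqueness of lifts of the image under f
   of the segment from a to x makes the section a two-sided inverse. *)

(** * Subgradients of small norm *)

(** Homogeneity is only an inequality for [s > 0], the form that infima preserve directly; applying
    it to [s] and [s^-1] gives equality. *)
Definition sublinear {R : realType} {V : lmodType R} (p : V -> R) : Prop :=
  (forall u v, p (u + v) <= p u + p v) /\
  (forall s v, 0 < s -> p (s *: v) <= s * p v).

Lemma sublinearZ {R : realType} {V : lmodType R} (p : V -> R) :
  sublinear p -> forall s v, 0 <= s -> p (s *: v) = s * p v.
Proof.
move=> [_ pZ] s v; rewrite le_eqVlt => /predU1P[<-|s0].
  rewrite scale0r mul0r.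
  have h1 : p 0 <= 2 * p 0 by have := pZ 2 0; rewrite scaler0 ltr0n; apply.
  have h2 : p 0 <= 2^-1 * p 0.
    by have := pZ 2^-1 0; rewrite scaler0 invr_gt0 ltr0n; apply.
  lra.
apply/le_anti; rewrite pZ//= -[v in leLHS](scalerK (lt0r_neq0 s0)).
by rewrite -ler_pdivlMl// pZ// invr_gt0.
Qed.

Lemma sublinear0 {R : realType} {V : lmodType R} (p : V -> R) :
  sublinear p -> p 0 = 0.
Proof. by move=> /sublinearZ/(_ 0 0 (lexx _)); rewrite scale0r mul0r. Qed.

Lemma sublinear_ge_opp {R : realType} {V : lmodType R} (p : V -> R) (v : V) :
  sublinear p -> - p (- v) <= p v.
Proof.
move=> p_sub; rewrite -subr_ge0 opprK -(sublinear0 _ p_sub) -(subrr v).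
exact: p_sub.1.
Qed.

Lemma lbound_inf_le {R : realType} (A : set R) (m x : R) :
  lbound A m -> A x -> inf A <= x.
Proof. by move=> Am; apply: ge_inf; exists m. Qed.

(* For fixed u, v |-> inf_(t >= 0) (p (v + t u) - t p u) is sublinear and at most
   p; minimality makes it equal to p, and t = 1 gives p v + p u <= p (v + u). *)
Lemma minimal_sublinear_linear {R : realType} {V : lmodType R} (p : V -> R) :
    sublinear p ->
    (forall p', sublinear p' -> (forall v, p' v <= p v) -> p' = p) ->
  linear (p : V -> R^o).
Proof.
move=> p_sub p_min.
have pD u v : p (v + u) = p v + p u.
  pose A v := [set p (v + t *: u) - t * p u | t in [set t : R | 0 <= t]].
  have Alb w : lbound (A w) (- p (- w)).
    move=> _ [t t0 <-]; rewrite lerBrDl lerBlDr -sublinearZ//.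
    by have := p_sub.1 (w + t *: u) (- w); rewrite addrAC subrr add0r.
  have An0 w : A w !=set0.
    by exists (p (w + 0 *: u) - 0 * p u); exists 0 => /=.
  have infA w t : 0 <= t -> inf (A w) <= p (w + t *: u) - t * p u.
    by move=> t0; apply: lbound_inf_le (Alb w) _; exists t.
  have Ap : (fun v => inf (A v)) = p.
    apply: p_min; last first.
      move=> w; apply: le_trans (infA w 0 (lexx _)) _.
      by rewrite scale0r addr0 mul0r subr0.
    split=> [w1 w2|s w s0].
      rewrite -lerBlDr; apply: lb_le_inf => // _ [t1 t10 <-].
      rewrite lerBlDr -lerBlDl; apply: lb_le_inf => // _ [t2 t20 <-].
      rewrite lerBlDl; apply: le_trans (infA _ _ (addr_ge0 t10 t20)) _.
      rewrite scalerDl addrACA mulrDl opprD [leRHS]addrACA lerD2r.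
      exact: p_sub.1.
    rewrite -ler_pdivrMl//; apply: lb_le_inf => // _ [t t0 <-].
    rewrite ler_pdivrMl//; apply: le_trans (infA _ _ (mulr_ge0 (ltW s0) t0)) _.
    by rewrite -scalerA -scalerDr (sublinearZ _ p_sub _ _ (ltW s0)) mulrBr mulrA.
  apply/eqP; rewrite eq_le p_sub.1/= -lerBrDr.
  by have := infA v 1 ler01; rewrite (congr1 (@^~ v) Ap) scale1r mul1r.
have p0 := sublinear0 _ p_sub.
have pN v : p (- v) = - p v by apply/eqP; rewrite -addr_eq0 -pD addNr p0.
move=> s u v; rewrite pD; congr (_ + _).
have [s0|s0] := leP 0 s; first by rewrite sublinearZ.
by rewrite -[s]opprK scaleNr pN sublinearZ ?oppr_ge0 ?(ltW s0)// scaleNr.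
Qed.

(** Zorn's lemma on the sublinear functionals below [q], ordered downwards: a nonempty chain is
    bounded by its pointwise infimum, and a minimal element is linear. *)
Lemma hahn_banach {R : realType} {V : lmodType R} (q : V -> R) :
  sublinear q -> exists w : {linear V -> R^o}, forall v, w v <= q v.
Proof.
move=> q_sub.
pose T := {p : V -> R | sublinear p /\ forall v, p v <= q v}.
pose r (a b : T) := `[< forall v, sval b v <= sval a v >].
have [||||[p [p_sub pq]] p_min] := @Zorn T r.
- by move=> a; apply/asboolP.
- move=> a b c /asboolP ab /asboolP bc; apply/asboolP => v.
  exact: le_trans (bc v) (ab v).
- move=> [a Pa] [b Pb] /asboolP ab /asboolP ba; apply: eq_exist.
  by apply/funext => v; apply/eqP; rewrite eq_le ab ba.
- move=> A A_tot.
  have [->|/set0P[a0 Aa0]] := eqVneq A set0.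
    by exists (exist _ q (conj q_sub (fun=> lexx _))).
  pose B v := [set sval a v | a in A].
  have Bn0 v : B v !=set0 by exists (sval a0 v); exists a0.
  (* The bound is the same for all members of the chain, so the infimum is finite. *)
  have Blb v : lbound (B v) (- q (- v)).
    move=> _ [[p [p_sub pq]] _ <-] /=.
    by apply: le_trans (sublinear_ge_opp _ _ p_sub); rewrite lerN2.
  have infB v a : A a -> inf (B v) <= sval a v.
    by move=> Aa; apply: lbound_inf_le (Blb v) _; exists a.
  have B_sub : sublinear (fun v => inf (B v)).
    split=> [u v|s v s0].
      rewrite -lerBlDr; apply: lb_le_inf => // _ [a Aa <-].
      rewrite lerBlDr -lerBlDl; apply: lb_le_inf => // _ [b Ab <-].
      rewrite lerBlDl.
      (* In a chain, the smaller of [a] and [b] serves at both points. *)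
      have [c [Ac ca cb]] : exists c, [/\ A c, sval c u <= sval a u
          & sval c v <= sval b v].
        by have [/asboolP|/asboolP] := A_tot _ _ Aa Ab; [exists b|exists a].
      apply: le_trans (infB _ _ Ac) _; apply: le_trans (lerD ca cb).
      exact: (svalP c).1.1.
    rewrite -ler_pdivrMl//; apply: lb_le_inf => // _ [a Aa <-].
    rewrite ler_pdivrMl//; apply: le_trans (infB _ _ Aa) _.
    exact: (svalP a).1.2.
  have Bq v : inf (B v) <= q v.
    by apply: le_trans (infB _ _ Aa0) _; exact: (svalP a0).2.
  exists (exist _ (fun v => inf (B v)) (conj B_sub Bq)) => a Aa.
  by apply/asboolP => v /=; exact: infB.
have p_lin : linear (p : V -> R^o).
  apply: minimal_sublinear_linear => // p' p'_sub p'p.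
  have p'q v : p' v <= q v := le_trans (p'p v) (pq v).
  by apply: (congr1 sval (p_min (exist _ p' (conj p'_sub p'q)) _)); exact/asboolP.
pose w : {linear V -> R^o} :=
  HB.pack (p : V -> R^o) (GRing.isLinear.Build _ _ _ _ _ p_lin).
by exists w.
Qed.

Lemma opnorm_ge0 {R : realType} {V W : normedModType R} (g : V -> W) :
  0 <= opnorm g.
Proof.
rewrite /opnorm; set A := [set _ | _ in _].
have [supA|/sup_out->//] := pselect (has_sup A).
apply: le_trans (ub_le_sup supA.2 _); last by exists 0; rewrite //= normr0.
exact: normr_ge0.
Qed.

Lemma opnorm_le {R : realType} {V W : normedModType R} (g : V -> W) (C : R) :
  (forall v, `|v| <= 1 -> `|g v| <= C) -> opnorm g <= C.
Proof.
move=> gC; apply: ge_sup; first by exists `|g 0|, 0; rewrite //= normr0.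
by move=> _ [v v1 <-]; exact: gC.
Qed.

Lemma bound_continuous_linear {R : realType} {V W : normedModType R}
    (T : {linear V -> W}) (C : R) :
  (forall v, `|T v| <= C * `|v|) -> continuous T.
Proof.
move=> TC; apply: bounded_linear_continuous; apply/linear_boundedP.
exists C; rewrite num_real; split=> // r Cr v.
by apply: le_trans (TC v) _; rewrite ler_wpM2r// ltW.
Qed.

Section clarke_lambda.
Context {R : realType} {X : normedModType R} (F : X -> R) (z : X).

(** The eventual upper bounds of the difference quotients at [z] along [v]. Their infimum is
    [clarke_dirderiv F z v]; real bounds avoid arithmetic with infinite values. *)
Let upper_slope (v : X) : set R := [set c : R | exists2 d : R, 0 < d &
  forall y t, `|y| < d -> 0 < t -> t < d ->
    F (z + y + t *: v) - F (z + y) <= t * c].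

Let upper_slope_dirderiv v r :
  (forall c, upper_slope v c -> r <= c) -> (r%:E <= clarke_dirderiv F z v)%E.
Proof.
move=> r_le; apply: le_ereal_inf_tmp => _ [A FA <-].
move: (FA) => [[U V] /= [/nbhs_norm0P[d1 d10 dU] /nbhs_normP[d2 d20 dV]] UVA].
pose d := Num.min d1 d2; have d0 : 0 < d by rewrite lt_min d10.
have Ad y t : `|y| < d -> 0 < t -> t < d -> A (y, t).
  rewrite !lt_min => /andP[yd _] t0 /andP[_ td]; apply: UVA; split => /=.
    exact: dU.
  by apply: dV => //=; rewrite sub0r normrN gtr0_norm.
(* A finite supremum is itself an upper slope; [+oo] is harmless, and [-oo] is impossible because
   [A] is nonempty. *)
case sA : ereal_sup => [c| |]; last 2 first.
- exact: leey.
- have A0 : A (0, d / 2) by apply: Ad; rewrite ?normr0 ?divr_gt0//; lra.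
  have : (((d / 2)^-1 * (F (z + 0 + (d / 2) *: v) - F (z + 0)))%:E <= -oo)%E.
    by rewrite -sA; apply: ereal_sup_ubound; exists (0, d / 2).
  by rewrite leeNy_eq.
rewrite lee_fin; apply: r_le; exists d => // y t yd t0 td.
rewrite -ler_pdivrMl// -lee_fin -sA; apply: ereal_sup_ubound.
by exists (y, t) => //; exact: Ad.
Qed.

Lemma clarke_lambda_ge0 : 0 <= clarke_lambda F z.
Proof.
rewrite /clarke_lambda; set A := [set _ | _ in _].
have [->|A0] := eqVneq A set0; first by rewrite inf0.
by apply: lb_le_inf; [exact/set0P|move=> _ [w _ <-]; exact: opnorm_ge0].
Qed.

(** Hahn-Banach is applied below a sublinear functional dominated both by the directional
    derivative, which makes [w] a subgradient, and by [k |v|], which bounds its norm. *)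
Lemma clarke_lambda_le (k : R) : 0 <= k ->
  (\forall x \near z, F z - k * `|x - z| <= F x) -> clarke_lambda F z <= k.
Proof.
move=> k0 /nbhs_normP[e e0 Fk].
have slope0 : upper_slope 0 0.
  by exists 1 => // y t _ _ _; rewrite scaler0 addr0 subrr mulr0.
have slopeD u v c d : upper_slope u c -> upper_slope v d ->
    upper_slope (u + v) (c + d).
  move=> [e1 e10 h1] [e2 e20 h2]; have v0 := normr_ge0 v.
  (* The increment along [u] starts at the shifted point [y + t *: v]; the first two radii keep this
     shift below [e1]. *)
  exists (Num.min (Num.min (e1 / 2) (e1 / 2 / (`|v| + 1))) e2).
    by rewrite !lt_min e20 !divr_gt0// ltr_wpDl.
  move=> y t; rewrite !lt_min => /andP[/andP[y1 _] y2] t0.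
  move=> /andP[/andP[t1 tv] t2].
  have -> : z + y + t *: (u + v) = z + (y + t *: v) + t *: u.
    by rewrite scalerDr (addrC (t *: u)) !addrA.
  rewrite -(subrK (F (z + (y + t *: v))) (F (_ + t *: u))) -addrA mulrDr lerD//.
    apply: h1 => //; last by lra.
    apply: le_lt_trans (ler_normD _ _) _.
    rewrite normrZ gtr0_norm// [ltRHS](splitr e1) ltrD//.
    move: tv; rewrite ltr_pdivlMr ?ltr_wpDl// => /(le_lt_trans _); apply.
    by rewrite ler_wpM2l ?(ltW t0)// lerDl.
  by rewrite addrA; exact: h2.
have slopeZ u c s : 0 < s -> upper_slope u c -> upper_slope (s *: u) (s * c).
  move=> s0 [e1 e10 h1]; exists (Num.min e1 (e1 / s)).
    by rewrite lt_min e10 divr_gt0.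
  move=> y t; rewrite !lt_min => /andP[y1 _] t0 /andP[_ ts].
  rewrite scalerA mulrA; apply: h1 => //; first by rewrite mulr_gt0.
  by rewrite -ltr_pdivlMr.
(* A small move from [z] itself along [u] confronts the slope with the assumed lower bound on
   [F]. *)
have slope_ge u c : upper_slope u c -> - (k * `|u|) <= c.
  move=> [e1 e10 h1]; have u0 := normr_ge0 u.
  pose t := Num.min (e1 / 2) (e / (`|u| + 1)).
  have t0 : 0 < t by rewrite lt_min !divr_gt0// ltr_wpDl.
  have te1 : t < e1 by rewrite gt_min; apply/orP; left; lra.
  have := h1 0 t; rewrite normr0 addr0 => /(_ e10 t0 te1).
  have : F z - k * `|z + t *: u - z| <= F (z + t *: u).
    apply: Fk; rewrite /= opprD addNKr normrN normrZ gtr0_norm//.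
    have : t <= e / (`|u| + 1) by rewrite ge_min lexx orbT.
    rewrite ler_pdivlMr ?ltr_wpDl// mulrDr mulr1 => h.
    by apply: lt_le_trans h; rewrite ltrDl.
  rewrite addrAC subrr add0r normrZ gtr0_norm// => h2 h3.
  by rewrite -(ler_pM2l t0) mulrN mulrCA; lra.
(* [inf (Q v)] is the infimal convolution of the directional derivative with
   k |.|; the assumption on F bounds it below by - k |v|, so it is finite even
   where the directional derivative is not. *)
pose Q v := [set p.2 + k * `|v - p.1| | p in [set p : X * R | upper_slope p.1 p.2]].
have Qlb v : lbound (Q v) (- (k * `|v|)).
  move=> _ [[u c] /= /slope_ge uc <-].
  have := ler_wpM2l k0 (ler_normD (u - v) v); rewrite subrK distrC mulrDr.
  by move: uc; lra.
have infQ v u c : upper_slope u c -> inf (Q v) <= c + k * `|v - u|.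
  by move=> uc; apply: lbound_inf_le (Qlb v) _; exists (u, c).
have Qn0 v : Q v !=set0 by exists (0 + k * `|v - 0|), (0, 0).
have [w wQ] : exists w : {linear X -> R^o}, forall v, w v <= inf (Q v).
  apply: hahn_banach; split=> [u v|s v s0].
    rewrite -lerBlDr; apply: lb_le_inf => // _ [[u1 c1] /= uc1 <-].
    rewrite lerBlDr -lerBlDl; apply: lb_le_inf => // _ [[u2 c2] /= uc2 <-].
    rewrite lerBlDl; apply: le_trans (infQ _ _ _ (slopeD _ _ _ _ uc1 uc2)) _.
    rewrite addrACA lerD2l -mulrDr ler_wpM2l// opprD addrACA.
    exact: ler_normD.
  rewrite -ler_pdivrMl//; apply: lb_le_inf => // _ [[u c] /= uc <-].
  rewrite ler_pdivrMl//; apply: le_trans (infQ _ _ _ (slopeZ _ _ _ s0 uc)) _.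
  by rewrite -scalerBr normrZ gtr0_norm// mulrDr lerD2l mulrCA.
have w_le v : w v <= k * `|v|.
  by apply: le_trans (wQ v) _; have := infQ v _ _ slope0; rewrite subr0 add0r.
have w_norm v : `|w v| <= k * `|v|.
  by rewrite ler_norml w_le andbT lerNl -linearN -normrN w_le.
have w_grad : clarke_gradient F z w.
  split; last first.
    move=> v; apply: upper_slope_dirderiv => c vc; apply: le_trans (wQ v) _.
    by have := infQ v _ _ vc; rewrite subrr normr0 mulr0 addr0.
  exact: bound_continuous_linear w_norm.
apply: (@le_trans _ _ (opnorm w)).
  apply: (@lbound_inf_le _ _ 0); last by exists w.
  by move=> _ [w' _ <-]; exact: opnorm_ge0.
apply: opnorm_le => v v1; apply: le_trans (w_norm v) _.
by rewrite -[leRHS]mulr1 ler_wpM2l.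
Qed.

End clarke_lambda.

(** * Ekeland's variational principle *)

Lemma homo_ltn_leq (phi : nat -> nat) :
  {homo phi : m n / (m < n)%N} -> forall n, (n <= phi n)%N.
Proof.
by move=> phi_incr; elim=> // n ih; exact: leq_ltn_trans ih (phi_incr _ _ (ltnSn n)).
Qed.

Lemma homo_ltn_cvg (phi : nat -> nat) :
  {homo phi : m n / (m < n)%N} -> phi n @[n --> \oo] --> \oo.
Proof.
move=> phi_incr P [N _ NP]; exists N => // n /= Nn; apply: NP.
exact: leq_trans Nn (homo_ltn_leq _ phi_incr n).
Qed.

(** One modulus yields both convergence and the distance of each term to the limit, as Ekeland's
    principle and [newton_iteration] need. *)
Lemma cvg_of_cauchy_bound {R : realType} {X : completeNormedModType R}
    (u : nat -> X) (e : nat -> R) :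
  e n @[n --> \oo] --> (0 : R) ->
  (forall n m, (n <= m)%N -> `|u m - u n| <= e n) ->
  exists2 l, u n @[n --> \oo] --> l & forall n, `|l - u n| <= e n.
Proof.
move=> e0 ue.
have /cvg_ex[l ul] : cvgn u.
  apply: cauchy_cvg; apply: cauchy_exP => r r0.
  have [N _ /(_ N (leqnn N))] := @cvgr0_norm_lt _ _ _ _ _ _ e0 _ r0.
  rewrite /= => eN; exists (u N), N => // m /= Nm.
  rewrite -ball_normE /ball_/= distrC.
  exact: le_lt_trans (le_trans (ue _ _ Nm) (ler_norm _)) eN.
exists l => // n.
have un : `|u m - u n| @[m --> \oo] --> `|l - u n|.
  by apply: cvg_norm; apply: cvgB => //; exact: cvg_cst.
rewrite -(cvg_lim _ un)//; apply: limr_le; first exact: cvgP un.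
by exists n => // m /= /ue.
Qed.

Lemma half_cvg0 {R : realType} (C : R) : C * 2^-1 ^+ n @[n --> \oo] --> (0 : R).
Proof.
rewrite -[X in _ --> X](mulr0 C); apply: cvgMr; apply: cvg_expr.
by rewrite gtr0_norm ?invr_gt0// invf_lt1// ltr1n.
Qed.

(** [S x] collects the successors of [x] for the order in which a step must lower [F] by at least
    [eta] times its length. Each [u n.+1] almost minimizes [F] among the successors of [u n], so the
    sets [S (u n)] shrink to one point. *)
Lemma ekeland {R : realType} {X : completeNormedModType R} (F : X -> R)
    (eta : R) (x0 : X) :
  0 < eta -> continuous F -> (forall x, 0 <= F x) ->
  exists z, F z + eta * `|z - x0| <= F x0 /\
            forall x, F z - eta * `|x - z| <= F x.
Proof.
move=> eta0 F_cont F_ge0.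
pose S x := [set z | F z + eta * `|z - x| <= F x].
have S_refl x : S x x by rewrite /S/= subrr normr0 mulr0 addr0.
have S_trans x y z : S x y -> S y z -> S x z.
  rewrite /S/= => xy yz; have := ler_wpM2l (ltW eta0) (ler_distD y z x).
  by rewrite mulrDr; lra.
have S_inf x z : S x z -> inf (F @` S x) <= F z.
  by move=> xz; apply: (@lbound_inf_le _ _ 0); [move=> _ [y _ <-]|exists z].
have next (p : nat * X) : {y | S p.2 y &
    forall z, S p.2 z -> F y <= F z + 2^-1 ^+ p.1}.
  case: p => n x /=; apply/cid2.
  have Fx : has_inf (F @` S x).
    by split; [exists (F x), x|exists 0 => _ [y _ <-]].
  have e0 : 0 < 2^-1 ^+ n :> R by rewrite exprn_gt0// invr_gt0.
  have [_ [y xy <-] yinf] := inf_adherent e0 Fx.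
  exists y => // z xz; apply: ltW (lt_le_trans yinf _).
  by rewrite lerD2r S_inf.
pose u := fix u n := if n is m.+1 then s2val (next (m, u m)) else x0.
have uS n : S (u n) (u n.+1) := s2valP (next (n, u n)).
have u_min n z : S (u n) z -> F (u n.+1) <= F z + 2^-1 ^+ n.
  exact: (s2valP' (next (n, u n))).
have S_le n m : (n <= m)%N -> S (u n) (u m).
  move=> /subnKC <-; elim: (m - n)%N => [|k ih]; first by rewrite addn0.
  by rewrite addnS; apply: S_trans ih (uS _).
have S_close n z : S (u n.+1) z -> `|z - u n.+1| <= eta^-1 * 2^-1 ^+ n.
  move=> uz; rewrite ler_pdivlMl//.
  by move: (uz) (u_min _ _ (S_trans _ _ _ (uS n) uz)); rewrite /S/=; lra.
have [z uz z_close] := cvg_of_cauchy_bound (u \o succn) _ (half_cvg0 eta^-1)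
  (fun n m nm => S_close _ _ (S_le n.+1 m.+1 nm)).
have zS n : S (u n) z.
  have cvg : F (u m.+1) + eta * `|u m.+1 - u n| @[m --> \oo]
      --> F z + eta * `|z - u n|.
    apply: cvgD; first by apply: continuous_cvg; [exact: F_cont|exact: uz].
    by apply: cvgMr; apply: cvg_norm; apply: cvgB => //; exact: cvg_cst.
  rewrite /S /= -(cvg_lim _ cvg)//; apply: limr_le; first exact: cvgP cvg.
  by exists n => // m /= nm; exact: (S_le n m.+1 (leqW nm)).
exists z; split; first exact: (zS 0%N).
move=> x; rewrite leNgt; apply/negP => xz.
(* A violation at [x] makes it a successor of [z], hence of every [u n]; it is then as close to
   [u n.+1] as [z] is, which forces [x = z]. *)
have zx : S z x by rewrite /S/=; lra.
suff : `|x - z| <= 0.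
  rewrite normr_le0 subr_eq0 => /eqP xz'; move: xz.
  by rewrite xz' subrr normr0 mulr0 subr0 ltxx.
have cvg0 : eta^-1 * 2^-1 ^+ n + eta^-1 * 2^-1 ^+ n @[n --> \oo] --> (0 : R).
  by rewrite -[X in _ --> X](addr0 0); apply: cvgD; exact: half_cvg0.
rewrite -(cvg_lim _ cvg0)//; apply: limr_ge; first exact: cvgP cvg0.
apply: nearW => n; rewrite -(subrK (u n.+1) x) -addrA.
apply: le_trans (ler_normD _ _) _; rewrite (distrC (u _)) lerD//.
  by apply: S_close; exact: S_trans (zS _) zx.
exact: S_close.
Qed.

(** * Bounded inverses and the local inverse theorem *)

(** Halving the residual at each step makes the step lengths a geometric series of sum
    [2 * C * |y - f x0|], so the iterates never leave the ball where steps are available. *)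
Lemma newton_iteration {R : realType} {X Y : completeNormedModType R}
    (f : X -> Y) (x0 : X) (y : Y) (C : R) :
    0 <= C -> continuous f ->
    (forall x, `|x - x0| <= 2 * C * `|y - f x0| -> `|y - f x| <= `|y - f x0| ->
      exists x', `|x' - x| <= C * `|y - f x| /\ `|y - f x'| <= `|y - f x| / 2) ->
  exists2 x, `|x - x0| <= 2 * C * `|y - f x0| & f x = y.
Proof.
move=> C0 f_cont step; set a := `|y - f x0| in step *.
have a0 : 0 <= a := normr_ge0 _.
have Ca0 : 0 <= C * a by rewrite mulr_ge0.
have /choice[next nextP] x : exists x', `|x - x0| <= 2 * C * a ->
    `|y - f x| <= a -> `|x' - x| <= C * `|y - f x| /\ `|y - f x'| <= `|y - f x| / 2.
  have [[h1 h2]|h] := pselect (`|x - x0| <= 2 * C * a /\ `|y - f x| <= a).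
    by have [x' x'P] := step x h1 h2; exists x'.
  by exists x => h1 h2; case: h.
pose u n := iter n next x0; pose q n : R := 2^-1 ^+ n.
have q0 n : 0 < q n by rewrite exprn_gt0// invr_gt0.
have q1 n : q n <= 1 by rewrite exprn_ile1// ?invf_le1 ?invr_ge0 ?ler1n.
have qS n : q n = 2 * q n.+1 by rewrite /q exprS mulrA mulfV// mul1r.
(* The factor [1 - q n] is the partial sum of the geometric series, normalized to 1. *)
have uP n : `|u n - x0| <= 2 * (C * a) * (1 - q n) /\ `|y - f (u n)| <= a * q n.
  elim: n => [|n [ih1 ih2]].
    by rewrite /u/= subrr normr0 /q expr0 subrr mulr0 mulr1.
  have un : `|u n - x0| <= 2 * C * a.
    by apply: le_trans ih1 _; have := mulr_ge0 Ca0 (ltW (q0 n)); lra.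
  have fun_le : `|y - f (u n)| <= a.
    by apply: le_trans ih2 _; rewrite -[leRHS]mulr1 ler_wpM2l.
  have [h1 h2] := nextP _ un fun_le.
  have h3 := ler_wpM2l C0 ih2; have h4 := ler_distD (u n) (next (u n)) x0.
  by rewrite /u iterS -/(u n); rewrite (qS n) in ih1 ih2 h3; split; lra.
have u_cauchy n m : (n <= m)%N -> `|u m - u n| <= 2 * (C * a) * q n.
  move=> nm; suff : `|u m - u n| <= 2 * (C * a) * (q n - q m).
    by move/le_trans; apply; rewrite ler_wpM2l ?mulr_ge0// gerBl ltW.
  rewrite -(subnKC nm); elim: (m - n)%N => [|k ih].
    by rewrite addn0 !subrr normr0 mulr0.
  have [h1 h2] := uP (n + k)%N.
  have un : `|u (n + k)%N - x0| <= 2 * C * a.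
    by apply: le_trans h1 _; have := mulr_ge0 Ca0 (ltW (q0 (n + k)%N)); lra.
  have fun_le : `|y - f (u (n + k)%N)| <= a.
    by apply: le_trans h2 _; rewrite -[leRHS]mulr1 ler_wpM2l.
  have [h3 _] := nextP _ un fun_le; have h4 := ler_wpM2l C0 h2.
  have h5 := ler_distD (u (n + k)%N) (next (u (n + k)%N)) (u n).
  rewrite addnS {1}/u iterS -/(u (n + k)%N).
  by rewrite (qS (n + k)%N) in ih h4; lra.
have [x ux x_le] := cvg_of_cauchy_bound u _ (half_cvg0 _) u_cauchy.
exists x; first by have := x_le 0%N; rewrite /q expr0 mulr1 mulrA.
apply/eqP; rewrite -subr_eq0 -normr_le0 distrC.
have cvg : `|y - f (u n)| @[n --> \oo] --> `|y - f x|.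
  apply: cvg_norm; apply: cvgB; first exact: cvg_cst.
  by apply: continuous_cvg; [exact: f_cont|exact: ux].
rewrite -(cvg_lim _ cvg)// -(cvg_lim _ (half_cvg0 a))//.
apply: ler_lim; [exact: cvgP cvg|exact: cvgP (half_cvg0 a)|].
by apply: nearW => n; exact: (uP n).2.
Qed.

(** Baire's theorem gives the closure of the image of some ball an interior point; every [y] is then
    approximated up to [|y| / 2] by the image of a vector of norm at most [C |y|], and
    [newton_iteration] makes this exact. *)
Lemma bounded_inverse {R : realType} {X Y : completeNormedModType R}
    (T : {linear X -> Y}) :
  continuous T -> bijective T ->
  exists2 C : R, 0 < C & forall x, `|x| <= C * `|T x|.
Proof.
move=> T_cont [S TK SK].
pose B n := closure (T @` ball (0 : X) n%:R).
have [n nB] : exists n, ~ dense (~` B n).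
  apply/existsNP => B_dense.
  have /(_ setT) : dense (\bigcap_n ~` B n).
    by apply: Baire => n; split => //; apply: closed_openC; exact: closed_closure.
  case; [by exists 0|exact: openT|move=> y [_ yB]].
  apply: (yB (Num.bound `|S y|) I); apply: subset_closure; exists (S y) => //.
  by rewrite -ball_normE /= sub0r normrN; apply: archi_boundP.
have [U [[y0 [U_open Uy0]] UB]] := denseNE nB.
have {U_open Uy0}[r r0 rU] : exists2 r : R, 0 < r & ball y0 r `<=` U.
  by move/open_nbhs_nbhs/nbhs_ballP: (conj U_open Uy0) => [r ? ?]; exists r.
have rB y e : `|y| < r -> 0 < e ->
    exists2 x, `|x| < n%:R & `|y0 + y - T x| < e.
  move=> yr e0.
  have : B n (y0 + y).
    apply: contrapT => yB; have : (U `&` ~` B n) (y0 + y).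
      by split=> //; apply: rU; rewrite -ball_normE /= opprD addNKr normrN.
    by rewrite UB.
  move=> /(_ _ (nbhsx_ballx _ _ e0))[_ [[x xn <-]]].
  rewrite -ball_normE /= => Tx; exists x => //.
  by move: xn; rewrite -ball_normE /= sub0r normrN.
(* [y] is rescaled to length [r / 2] and reached by a difference of two vectors of norm below [n];
   [n.+1] keeps [C] positive. *)
pose C := 4 * n.+1%:R / r.
have C0 : 0 < C by rewrite divr_gt0// mulr_gt0.
have step y : exists x, `|x| <= C * `|y| /\ `|y - T x| <= `|y| / 2.
  have [->|y_neq0] := eqVneq y 0.
    by exists 0; rewrite linear0 subrr !normr0 mulr0 mul0r.
  have y_gt0 : 0 < `|y| by rewrite normr_gt0.
  pose s := r / 2 / `|y|.
  have s0 : 0 < s by rewrite !divr_gt0.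
  have e0 : 0 < s * `|y| / 4 by rewrite divr_gt0// mulr_gt0.
  have sy : `|s *: y| < r.
    by rewrite normrZ gtr0_norm// divfK ?gt_eqF//; lra.
  have [x1 x1n Tx1] := rB _ _ sy e0.
  (* A second approximation, of the centre [y0], is subtracted; the two errors add up to half of the
     rescaled length. *)
  have [x2 x2n Tx2] : exists2 x, `|x| < n%:R & `|y0 + 0 - T x| < s * `|y| / 4.
    by apply: rB => //; rewrite normr0.
  exists (s^-1 *: (x1 - x2)).
  rewrite linearZ -[y in `|y - _|](scalerK (lt0r_neq0 s0)) -scalerBr !normrZ.
  rewrite gtr0_norm ?invr_gt0// !ler_pdivrMl//.
  split.
    have -> : s * (C * `|y|) = 2 * n.+1%:R.
      by rewrite /s /C; field; rewrite !gt_eqF.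
    by have := ler_normB x1 x2; rewrite -natr1; lra.
  rewrite linearB; have := ler_normB (y0 + s *: y - T x1) (y0 + 0 - T x2).
  have -> : y0 + s *: y - T x1 - (y0 + 0 - T x2) = s *: y - (T x1 - T x2).
    by rewrite addr0 !opprD !opprK addrACA [y0 + _]addrC addrK.
  by lra.
exists (2 * C) => [|x]; first by rewrite mulr_gt0.
have [|||x'] := @newton_iteration _ _ _ T 0 (T x) C.
- exact: ltW.
- exact: T_cont.
- move=> z _ _; have [v [v1 v2]] := step (T x - T z).
  by exists (z + v); rewrite addrAC subrr add0r linearD opprD addrA.
move=> + /(can_inj TK) x'x; rewrite x'x (linear0 T) => x_le; move: x_le.
by rewrite !subr0.
Qed.

(** * Real induction and the mean value inequality *)

(** Real induction: let [sup B] be the supremum of the [t] such that [P] holds on [0, t]. [P] holds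
    there by the second premise, and the third excludes that it is below 1. *)
Lemma unit_interval_ind {R : realType} (P : R -> Prop) :
    P 0 ->
    (forall t : R, 0 < t -> t <= 1 -> (forall s : R, 0 <= s -> s < t -> P s) -> P t) ->
    (forall t : R, 0 <= t -> t < 1 -> P t -> \forall s \near t, t < s -> P s) ->
  P 1.
Proof.
move=> P0 P_closed P_open.
pose B := [set t : R | 0 <= t <= 1 /\ forall s, 0 <= s -> s <= t -> P s].
have B0 : B 0.
  by split=> [|s s0 s0']; rewrite ?lexx ?ler01//; have -> : s = 0 by lra.
have supB : has_sup B by split; [exists 0|exists 1 => t [/andP[]]].
have tau0 : 0 <= sup B := ub_le_sup supB.2 B0.
have tau1 : sup B <= 1 by apply: ge_sup supB.1 _ => t [/andP[]].
have P_lt s : 0 <= s -> s < sup B -> P s.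
  by move=> s0 /(sup_gt supB.1)[t [_ tP] st]; apply: tP => //; exact: ltW.
have P_tau : P (sup B).
  by move: tau0; rewrite le_eqVlt => /predU1P[<-//|tau0]; apply: P_closed.
move: tau1; rewrite le_eqVlt => /predU1P[<-//|tau1].
have /nbhs_normP[d /= d0 dP] := P_open _ tau0 tau1 P_tau.
pose t := Num.min (sup B + d / 2) 1.
have Bt : B t.
  split=> [|s s0].
    by rewrite /t ge_min lexx orbT andbT le_min ler01 andbT addr_ge0 ?divr_ge0// ltW.
  rewrite le_min => /andP[sd s1].
  have [|/[dup] s_tau] := ltrP s (sup B); first exact: P_lt.
  rewrite le_eqVlt => /predU1P[<-//|]; apply: dP => /=.
  by rewrite distrC ger0_norm ?subr_ge0//; lra.
have := ub_le_sup supB.2 Bt; rewrite leNgt => /negP[].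
by rewrite lt_min tau1 ltrDl divr_gt0.
Qed.

(** Real induction on [|c t - c 0| <= K * t]. The local bound at [t] compares it with points on
    either side, so both inductive steps are triangle inequalities. *)
Lemma path_mean_value {R : realType} {Y : normedModType R} (c : R -> Y) (K : R) :
    (forall t : R, 0 <= t -> t <= 1 ->
      \forall s \near t, `|c s - c t| <= K * `|s - t|) ->
  `|c 1 - c 0| <= K.
Proof.
move=> cK; rewrite -[leRHS]mulr1.
apply: (unit_interval_ind (fun t => `|c t - c 0| <= K * t)) => [|t t0 t1 ih|t t0 t1 ih].
- by rewrite subrr normr0 mulr0.
- have /nbhs_normP[d /= d0 dK] := cK _ (ltW t0) t1.
  (* An earlier time within [d] of [t] that is still nonnegative. *)
  pose s := t - Num.min (d / 2) t.
  have sm : 0 < Num.min (d / 2) t by rewrite lt_min t0 divr_gt0.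
  have st : s < t by rewrite /s; lra.
  have s0 : 0 <= s by rewrite /s subr_ge0 ge_min lexx orbT.
  have ds : `|t - s| < d.
    rewrite gtr0_norm ?subr_gt0// /s opprB addrC subrK gt_min.
    by apply/orP; left; lra.
  have := dK s ds; rewrite -normrN opprB (distrC s) gtr0_norm ?subr_gt0// => h.
  have := ih s s0 st; have := ler_distD (c s) (c t) (c 0); lra.
- near=> s => ts.
  have : `|c s - c t| <= K * `|s - t| by near: s; apply: cK => //; exact: ltW.
  rewrite gtr0_norm ?subr_gt0//.
  have := ler_distD (c t) (c s) (c 0); lra.
Unshelve. all: by end_near. Qed.

(** Differentiability only yields local constants [K + e]; the slack is taken as [e / M], so that it
    costs at most [e] over the whole segment. *)
Lemma mean_value_le {R : realType} {X Y : normedModType R} (g : X -> Y)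
    (a b : X) (K : R) :
    (forall t : R, 0 <= t -> t <= 1 -> forall e : R, 0 < e ->
      \forall y \near a + t *: (b - a),
        `|g y - g (a + t *: (b - a))| <= (K + e) * `|y - (a + t *: (b - a))|) ->
  `|g b - g a| <= K * `|b - a|.
Proof.
move=> gK; apply/ler_addgt0Pr => e e0.
pose M := `|b - a| + 1.
have M0 : 0 < M by rewrite ltr_wpDl.
pose c (t : R) := g (a + t *: (b - a)).
have -> : g b = c 1 by rewrite /c scale1r addrC subrK.
have -> : g a = c 0 by rewrite /c scale0r addr0.
apply: (@le_trans _ _ ((K + e / M) * `|b - a|)); last first.
  rewrite mulrDl lerD2l mulrAC ler_pdivrMr// ler_wpM2l ?(ltW e0)//.
  by rewrite /M lerDl.
apply: path_mean_value => t t0 t1.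
have line_cont : (a + s *: (b - a)) @[s --> t] --> a + t *: (b - a).
  by apply: cvgD; [exact: cvg_cst|apply: cvgZr_tmp; exact: cvg_id].
have := line_cont _ (gK t t0 t1 (e / M) (divr_gt0 e0 M0)).
rewrite !near_simpl; apply: filterS => s /= h; apply: le_trans h _.
rewrite opprD addrACA subrr add0r -scalerBl normrZ.
by rewrite mulrA mulrAC.
Qed.

Lemma ball_segment {R : realType} {V : normedModType R} (x0 a b : V) (d t : R) :
  ball x0 d a -> ball x0 d b -> 0 <= t -> t <= 1 -> ball x0 d (a + t *: (b - a)).
Proof.
rewrite -!ball_normE /= => ad bd t0 t1.
have -> : x0 - (a + t *: (b - a)) = (1 - t) *: (x0 - a) + t *: (x0 - b).
  rewrite scalerBl scale1r -[RHS]addrA -scalerN -scalerDr opprB [a - _ + _]addrA.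
  by rewrite subrK opprD addrA -scalerN opprB.
apply: le_lt_trans (ler_normD _ _) _; rewrite !normrZ !ger0_norm ?subr_ge0//.
have [->|t_gt0] := eqVneq t 0; first by rewrite subr0 mul1r mul0r addr0.
have : 0 < t by rewrite lt_neqAle eq_sym t_gt0.
by nra.
Qed.

(** * Estimates for C1 maps and local inversion *)

(** Only homogeneity is asked, so that differences of differentials qualify; the a priori bound [C]
    makes the supremum genuine. *)
Lemma le_opnorm {R : realType} {V W : normedModType R} (g : V -> W) (C : R) :
    (forall s v, g (s *: v) = s *: g v) -> (forall v, `|g v| <= C * `|v|) ->
  forall v, `|g v| <= opnorm g * `|v|.
Proof.
move=> gZ gC v.
have [->|v_neq0] := eqVneq v 0.
  by rewrite -[X in g X](scale0r 0) gZ scale0r !normr0 mulr0.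
have v_gt0 : 0 < `|v| by rewrite normr_gt0.
rewrite -ler_pdivrMr// mulrC -[X in X * _]gtr0_norm ?invr_gt0// -normrZ -gZ.
apply: ub_le_sup; last first.
  by exists (`|v|^-1 *: v) => //=; rewrite normrZ gtr0_norm ?invr_gt0// mulVf ?gt_eqF.
exists `|C| => _ [u /= u1 <-]; apply: le_trans (gC u) _.
apply: le_trans (ler_norm _) _; rewrite normrM normr_id.
by rewrite -[leRHS]mulr1 ler_wpM2l.
Qed.

Lemma continuous_linear_bound {R : realType} {V W : normedModType R}
    (T : {linear V -> W}) :
  continuous T -> exists2 C : R, 0 < C & forall v, `|T v| <= C * `|v|.
Proof.
move=> /linear_bounded_continuous/linear_boundedP/pinfty_ex_gt0[C C0 TC].
by exists C.
Qed.

Lemma differentiable_near {R : realType} {V W : normedModType R} (f : V -> W)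
    (x : V) (e : R) : differentiable f x -> 0 < e ->
  \forall y \near x, `|f y - f x - 'd f x (y - x)| <= e * `|y - x|.
Proof.
move=> /diffP[_ fx] e0.
have /eqaddoP/(_ e e0) : f = (fun y => f x + 'd f x (y - x)) +o_x (fun y => y - x).
  by apply/eqaddoE/funext => y; rewrite fx lim_id.
by apply: filterS => y /=; rewrite !fctE opprD addrA.
Qed.

Lemma near_differentiable {R : realType} {V W : normedModType R} (f : V -> W)
    (x : V) (T : {linear V -> W}) : continuous T ->
  (forall e, 0 < e -> \forall y \near x, `|f y - f x - T (y - x)| <= e * `|y - x|) ->
  differentiable f x /\ 'd f x = T :> (V -> W).
Proof.
move=> T_cont fT.
have fTo : f \o shift x = cst (f x) + T +o_ 0 id.
  apply/eqaddoP => e e0; have := fT e e0.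
  rewrite (near_shift 0 x) => h; apply: filterS h => y /=.
  by rewrite !fctE subr0 addrK opprD addrA.
have d := diff_unique T_cont fTo.
split; last exact: d.
by apply/diff_locallyP; rewrite d.
Qed.

Lemma C1_map_near {R : realType} {V W : normedModType R} (f : V -> W) (x0 : V)
    (e : R) : C1_map f -> 0 < e ->
  \forall x \near x0, forall v, `|'d f x v - 'd f x0 v| <= e * `|v|.
Proof.
move=> [f_diff f_cont] e0.
apply: filterS (@cvgr0_norm_lt _ _ _ _ _ _ (f_cont x0) _ e0) => x xe v.
have [C1 _ hC1] := continuous_linear_bound _ (diff_continuous (f_diff x)).
have [C2 _ hC2] := continuous_linear_bound _ (diff_continuous (f_diff x0)).
have := le_opnorm (fun v => 'd f x v - 'd f x0 v) (C1 + C2).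
move=> /(_ _ _ v) h; apply: le_trans (h _ _) _.
- by move=> s u; rewrite 2!linearZ_LR scalerBr.
- by move=> u; apply: le_trans (ler_normB _ _) _; rewrite mulrDl lerD.
- by rewrite ler_wpM2r// ltW// (le_lt_trans (ler_norm _) xe).
Qed.

Lemma C1_map_continuous {R : realType} {V W : normedModType R} (f : V -> W) :
  C1_map f -> continuous f.
Proof. by move=> [f_diff _] x; apply: differentiable_continuous. Qed.

Lemma C1_map_mean_value {R : realType} {V W : normedModType R} (f : V -> W)
    (T : {linear V -> W}) (x0 a b : V) (d K : R) : C1_map f ->
    (forall x v, ball x0 d x -> `|'d f x v - T v| <= K * `|v|) ->
    ball x0 d a -> ball x0 d b ->
  `|f b - f a - T (b - a)| <= K * `|b - a|.
Proof.
move=> fC1 fT ad bd.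
have -> : f b - f a - T (b - a) = (f b - T b) - (f a - T a).
  by rewrite linearB !opprD !opprK addrACA.
apply: (mean_value_le (fun x => f x - T x)) => t t0 t1 e e0.
set x := a + t *: (b - a).
have xd : ball x0 d x by apply: ball_segment.
have := differentiable_near f x e (fC1.1 x) e0.
apply: filterS => y fy.
have -> : f y - T y - (f x - T x) =
    (f y - f x - 'd f x (y - x)) + ('d f x (y - x) - T (y - x)).
  by rewrite addrA subrK [in RHS]linearB !opprD !opprK addrACA.
apply: le_trans (ler_normD _ _) _.
by rewrite mulrDl addrC lerD// fT.
Qed.

(** Where ['d f] is within [1 / (2C)] of ['d f x0], the map [f - 'd f x0] has Lipschitz constant
    [1 / (2C)]. This gives the injectivity estimate, and Newton steps with the fixed inverse [S]
    halve the residual. *)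
Lemma local_C1_diffeo_inverse {R : realType} {X Y : completeNormedModType R}
    (f : X -> Y) (x0 : X) : local_C1_diffeo f ->
  exists d r C : R, [/\ 0 < d, 0 < r,
    forall x x', ball x0 d x -> ball x0 d x' -> `|x - x'| <= C * `|f x - f x'| &
    forall y, ball (f x0) r y -> exists2 x, ball x0 d x & f x = y].
Proof.
move=> [fC1 f_bij].
have [C C0 TC] := bounded_inverse _ (diff_continuous (fC1.1 x0)) (f_bij x0).
have [S TS ST] := f_bij x0.
have K0 : 0 < (2 * C)^-1 by rewrite invr_gt0 mulr_gt0.
have /nbhs_ballP[d /= d0 fd] := C1_map_near f x0 _ fC1 K0.
have mv a b : ball x0 d a -> ball x0 d b ->
    `|f b - f a - 'd f x0 (b - a)| <= (2 * C)^-1 * `|b - a|.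
  by apply: (C1_map_mean_value _ _ x0) => // x v /fd.
have CK : C * (2 * C)^-1 = 2^-1 by rewrite invfM mulrCA mulfV ?gt_eqF// mulr1.
(* For [y] in this smaller ball the iterates stay within [d / 2] of [x0] and a further step is
   shorter than [d / 4]. *)
exists d, (d / (4 * C)), (2 * C); split => //.
- by rewrite divr_gt0// mulr_gt0.
- move=> x x' xd x'd; have h1 := ler_wpM2l (ltW C0) (mv _ _ x'd xd).
  have h2 := TC (x - x').
  have h3 := ler_wpM2l (ltW C0) (ler_normB (f x - f x') (f x - f x' - 'd f x0 (x - x'))).
  move: h3; rewrite opprB addrC subrK => h3.
  by move: h1; rewrite mulrA CK; lra.
- move=> y; rewrite -ball_normE /= distrC ltr_pdivlMr ?mulr_gt0// => yr.
  have f_cont := C1_map_continuous f fC1.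
  have [|x xd fx] := newton_iteration f x0 y C (ltW C0) f_cont.
    move=> x xle fxle; set w := S (y - f x).
    have Tw : 'd f x0 w = y - f x by rewrite /w ST.
    have wle := TC w; rewrite Tw in wle.
    have h1 := ler_wpM2l (ltW C0) fxle.
    have h2 := ler_normD (x - x0) w; have h3 := normr_ge0 (x - x0).
    have [xd xwd] : ball x0 d x /\ ball x0 d (x + w).
      by rewrite -!ball_normE /= ![`|x0 - _|]distrC (addrAC x); split; lra.
    exists (x + w); rewrite addrAC subrr add0r; split=> //.
    have := mv _ _ xd xwd; rewrite (addrAC x w) subrr add0r Tw.
    rewrite opprB addrA subrK distrC => h; apply: le_trans h _.
    by rewrite ler_pdivrMl ?mulr_gt0//; lra.
  exists x => //; rewrite -ball_normE /= distrC; apply: le_lt_trans xd _.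
  by have := mulr_ge0 (ltW C0) (normr_ge0 (y - f x0)); lra.
Qed.

(** * Lifting through a proper local homeomorphism *)

(** Real induction on [c1 t = c2 t]: continuity passes equality to the limit, local injectivity
    propagates it to the right. *)
Lemma lift_unique {R : realType} {X Y : normedModType R} (f : X -> Y)
    (c1 c2 : R -> X) :
    (forall x, exists2 d : R, 0 < d & forall x1 x2,
      ball x d x1 -> ball x d x2 -> f x1 = f x2 -> x1 = x2) ->
    (forall t : R, 0 <= t -> t <= 1 -> {for t, continuous c1}) ->
    (forall t : R, 0 <= t -> t <= 1 -> {for t, continuous c2}) ->
    (forall t : R, 0 <= t -> t <= 1 -> f (c1 t) = f (c2 t)) ->
  c1 0 = c2 0 -> c1 1 = c2 1.
Proof.
move=> f_inj c1_cont c2_cont fc c0.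
apply: (unit_interval_ind (fun t => c1 t = c2 t)) => // [t t0 t1 ih|t t0 t1 ct].
  apply: contrapT => /eqP; rewrite -subr_eq0 -normr_gt0 => neq.
  have cvg : c1 s - c2 s @[s --> t] --> c1 t - c2 t.
    by apply: cvgB; [apply: c1_cont|apply: c2_cont] => //; exact: ltW.
  have /nbhs_normP[d /= d0 dP] : \forall s \near t, `|c1 s - c2 s| > 0.
    have cvgn : `|c1 s - c2 s| @[s --> t] --> `|c1 t - c2 t| by exact: cvg_norm.
    exact: (cvgr_gt _ cvgn).
  pose s := t - Num.min (d / 2) t.
  have sm : 0 < Num.min (d / 2) t by rewrite lt_min t0 divr_gt0.
  have st : s < t by rewrite /s; lra.
  have s0 : 0 <= s by rewrite /s subr_ge0 ge_min lexx orbT.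
  have ds : `|t - s| < d.
    rewrite gtr0_norm ?subr_gt0// /s opprB addrC subrK gt_min.
    by apply/orP; left; lra.
  by have := dP s ds; rewrite ih// subrr normr0 ltxx.
have [d d0 d_inj] := f_inj (c1 t).
have near1 : \forall s \near t, ball (c1 t) d (c1 s).
  by apply: c1_cont; [|exact: ltW|exact: nbhsx_ballx].
have near2 : \forall s \near t, ball (c1 t) d (c2 s).
  by rewrite ct; apply: c2_cont; [|exact: ltW|exact: nbhsx_ballx].
have near3 : \forall s \near t, s < 1 by exact: lt_nbhsl.
near=> s => ts; apply: d_inj.
- by near: s.
- by near: s.
- by apply: fc; [exact: le_trans t0 (ltW ts)|apply: ltW; near: s].
Unshelve. all: by end_near. Qed.

Section star_section.
Context {R : realType} {X Y : normedModType R} (f : X -> Y) (a : X).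
Hypothesis f_cont : continuous f.
Hypothesis f_local : forall x, exists d r C : R, [/\ 0 < d, 0 < r,
  forall x1 x2, ball x d x1 -> ball x d x2 -> `|x1 - x2| <= C * `|f x1 - f x2| &
  forall y, ball (f x) r y -> exists2 x1, ball x d x1 & f x1 = y].
Hypothesis f_proper : forall (u : nat -> X) (y : Y),
  f (u n) @[n --> \oo] --> y -> exists2 phi : nat -> nat,
    {homo phi : m n / (m < n)%N} & cvgn (u \o phi).

Let line (y : Y) (t : R) := f a + t *: (y - f a).

Let line0 y : line y 0 = f a. Proof. by rewrite /line scale0r addr0. Qed.
Let line1 y : line y 1 = y. Proof. by rewrite /line scale1r addrC subrK. Qed.
Let line_line y s t : line (line y s) t = line y (t * s).
Proof. by rewrite /line addrAC subrr add0r scalerA. Qed.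

Let line_cont y : continuous (line y).
Proof.
move=> t; apply: cvgD; [exact: cvg_cst|apply: cvgZr_tmp; exact: cvg_id].
Qed.

Let f_inj x : exists2 d : R, 0 < d &
  forall x1 x2, ball x d x1 -> ball x d x2 -> f x1 = f x2 -> x1 = x2.
Proof.
have [d [r [C [d0 _ fC _]]]] := f_local x; exists d => //.
move=> x1 x2 x1d x2d fx; apply/eqP.
by rewrite -subr_eq0 -normr_le0 (le_trans (fC _ _ x1d x2d))// fx subrr normr0 mulr0.
Qed.

(** Choice turns local surjectivity into a map [psi]; the inverse Lipschitz estimate makes it a
    local left inverse and continuous. *)
Let local_section x : exists d r : R, [/\ 0 < d, 0 < r & exists psi : Y -> X,
  [/\ forall x1, ball x d x1 -> ball (f x) r (f x1) -> psi (f x1) = x1,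
      forall y, ball (f x) r y -> f (psi y) = y &
      forall y, ball (f x) r y -> {for y, continuous psi}]].
Proof.
have [d [r [C [d0 r0 fC f_surj]]]] := f_local x.
have /choice[psi psiP] y : exists x1, ball (f x) r y -> ball x d x1 /\ f x1 = y.
  have [/f_surj[x1]|] := pselect (ball (f x) r y); first by exists x1.
  by exists x.
(* The sign of [C] is unknown; this is a positive replacement. *)
have C1 : 0 < `|C| + 1 by rewrite ltr_wpDl.
exists d, r; split=> //; exists psi; split=> [x1 x1d x1r|y /psiP[]//|y yr].
  have [p1 p2] := psiP _ x1r; apply/eqP; rewrite -subr_eq0 -normr_le0.
  by rewrite (le_trans (fC _ _ p1 x1d))// p2 subrr normr0 mulr0.
apply/cvgrPdist_lt => e e0.
have [p1 p2] := psiP _ yr.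
near=> y'.
have [q1 q2] : ball x d (psi y') /\ f (psi y') = y'.
  by apply: psiP; near: y'; apply: open_nbhs_nbhs; split => //; exact: ball_open.
apply: le_lt_trans (fC _ _ p1 q1) _; rewrite p2 q2.
apply: (@le_lt_trans _ _ ((`|C| + 1) * `|y - y'|)).
  by rewrite ler_wpM2r// (le_trans (ler_norm C))// lerDl.
rewrite -ltr_pdivlMl//; near: y'; apply: cvgr_dist_lt; first exact: cvg_id.
by rewrite mulr_gt0 ?invr_gt0.
Unshelve. all: by end_near. Qed.

(** The last clause makes [V] star-shaped about [f a], so that two sections can be compared along
    segments issued from [f a]. *)
Let star_section (V : set Y) (g : Y -> X) := [/\ open V, V (f a), g (f a) = a &
  forall y, V y -> [/\ f (g y) = y, {for y, continuous g} &
    forall t : R, 0 <= t -> t <= 1 -> V (line y t)]].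

Let section_unique V1 V2 g1 g2 y : star_section V1 g1 -> star_section V2 g2 ->
  V1 y -> V2 y -> g1 y = g2 y.
Proof.
move=> [_ _ g1a V1P] [_ _ g2a V2P] /V1P[_ _ V1y] /V2P[_ _ V2y].
rewrite -(line1 y).
apply: (lift_unique f (g1 \o line y) (g2 \o line y) f_inj)
  => [t t0 t1|t t0 t1|t t0 t1|] /=.
- by apply: continuous_comp; [exact: line_cont|have [] := V1P _ (V1y t t0 t1)].
- by apply: continuous_comp; [exact: line_cont|have [] := V2P _ (V2y t t0 t1)].
- by have [-> _ _] := V1P _ (V1y t t0 t1); have [-> _ _] := V2P _ (V2y t t0 t1).
- by rewrite line0 g1a g2a.
Qed.

(** By [section_unique] all star sections agree on overlaps, so their union is again one. *)
Let maximal_section : exists V g, star_section V g /\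
  forall V' g', star_section V' g' -> V' `<=` V.
Proof.
pose V y := exists p : set Y * (Y -> X), star_section p.1 p.2 /\ p.1 y.
have /choice[g gP] y : exists x, forall V' g', star_section V' g' -> V' y -> g' y = x.
  have [[[V0 g0] [/= s0 V0y]]|h] := pselect (V y).
    by exists (g0 y) => V' g' s' V'y; apply: section_unique s' s0 V'y V0y.
  by exists a => V' g' s' V'y; case: h; exists (V', g').
exists V, g; split; last by move=> V' g' s' y V'y; exists (V', g').
have [d [r [d0 r0 [psi [psi_f fpsi psi_cont]]]]] := local_section a.
have psi_a : psi (f a) = a by apply: psi_f; exact: ballxx.
have s0 : star_section (ball (f a) r) psi.
  split=> //; [exact: ball_open|exact: ballxx|].
  move=> y yr; split=> [||t t0 t1]; [exact: fpsi|exact: psi_cont|].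
  move: yr; rewrite -!ball_normE /= /line opprD addNKr normrN normrZ ger0_norm//.
  by rewrite distrC; apply: le_lt_trans; rewrite -[leRHS]mul1r ler_wpM2r.
split.
- rewrite openE => y [[V' g'] /= [s' V'y]]; have [V'_open _ _ _] := s'.
  apply: filterS (open_nbhs_nbhs (conj V'_open V'y)) => z V'z.
  by exists (V', g').
- by exists (ball (f a) r, psi); split=> //=; exact: ballxx.
- by rewrite -(gP _ _ _ s0)//; exact: ballxx.
- move=> y [[V' g'] /= [s' V'y]]; have [V'_open _ _ V'P] := s'.
  have [fg' g'_cont V'line] := V'P _ V'y.
  split; first by rewrite -(gP _ _ _ s').
    have gg' : \forall z \near y, g' z = g z.
      apply: filterS (open_nbhs_nbhs (conj V'_open V'y)) => z V'z.
      exact: gP s' V'z.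
    rewrite /prop_for /continuous_at -(gP _ _ _ s' V'y).
    exact: cvg_trans (near_eq_cvg gg') g'_cont.
  by move=> t t0 t1; exists (V', g'); split=> //=; exact: V'line.
Qed.

Let line_between y (k th : R) :
  line y (k + th * (1 - k)) = line y k + th *: (y - line y k).
Proof.
have -> : y - line y k = (1 - k) *: (y - f a).
  by rewrite /line opprD addrA scalerBl scale1r.
by rewrite /line (scalerDl _ k) addrA scalerA.
Qed.

(** Properness yields a limit point [x] of [g] along the segment as the parameter increases to [t].
    A local section [psi] at [x] is glued to [g] on a set which keeps the union star-shaped. *)
Let section_extend V g y t : star_section V g -> 0 < t ->
    (forall s, 0 <= s -> s < t -> V (line y s)) ->
  exists V' g', [/\ star_section V' g', V `<=` V' & V' (line y t)].
Proof.
move=> [V_open Va ga VP] t0 yV; set p := line y t.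
(* With [n.+1] instead of [n.+2] the first parameter would be 0. *)
pose tau n : R := t - t * n.+2%:R^-1.
have tauP n : 0 < tau n /\ tau n < t.
  have n0 : 0 < n.+2%:R^-1 :> R by rewrite invr_gt0.
  have n1 : n.+2%:R^-1 < 1 :> R by rewrite invf_lt1// ltr1n.
  by rewrite /tau subr_gt0 gtrBl mulr_gt0// gtr_pMr.
have Vtau n : V (line y (tau n)).
  by apply: yV; [exact: ltW (tauP n).1|exact: (tauP n).2].
have tau_cvg : tau n @[n --> \oo] --> t.
  rewrite -[X in _ --> X]subr0 -[X in _ --> _ - X](mulr0 t).
  apply: cvgB; first exact: cvg_cst.
  apply: cvgMr; have := @cvg_harmonic R; rewrite -(@cvg_shiftS R).
  by apply.
have f_cvg : f (g (line y (tau n))) @[n --> \oo] --> p.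
  under eq_fun => n do have [-> _ _] := VP _ (Vtau n).
  by apply: continuous_cvg; [exact: line_cont|exact: tau_cvg].
have [phi phi_incr /cvg_ex[x ux]] := f_proper _ _ f_cvg.
have phi_cvg := homo_ltn_cvg _ phi_incr.
have fx : f x = p.
  have h1 : f (g (line y (tau (phi n)))) @[n --> \oo] --> f x.
    by apply: continuous_cvg; [exact: f_cont|exact: ux].
  have h2 : f (g (line y (tau (phi n)))) @[n --> \oo] --> p.
    exact: (cvg_comp _ _ phi_cvg f_cvg).
  exact: cvg_unique h1 h2.
have [d [r [d0 r0 [psi [psi_f fpsi psi_cont]]]]] := local_section x.
rewrite fx in psi_f fpsi psi_cont.
(* One parameter is late enough for the point to be near [p] and for its lift to be near [x]. *)
have [n qd qr] : exists2 n, ball x d (g (line y (tau n))) & ball p r (line y (tau n)).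
  have line_cvg : line y (tau (phi n)) @[n --> \oo] --> p.
    apply: continuous_cvg; first exact: line_cont.
    exact: (cvg_comp _ _ phi_cvg tau_cvg).
  near \oo => n; exists (phi n); near: n.
    exact: ux (nbhsx_ballx _ _ d0).
  exact: line_cvg (nbhsx_ballx _ _ r0).
set q := line y (tau n) in qd qr.
have [e e0 qe] : exists2 e : R, 0 < e & forall z, ball q e z ->
    [/\ V z, ball p r z & ball x d (g z)].
  have Vq : V q := Vtau n.
  have : \forall z \near q, [/\ V z, ball p r z & ball x d (g z)].
    near=> z; split; near: z.
    - exact: open_nbhs_nbhs.
    - by apply: open_nbhs_nbhs; split=> //; exact: ball_open.
    - have [_ gq _] := VP _ Vq; apply: gq.
      by apply: open_nbhs_nbhs; split=> //; exact: ball_open.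
  by move=> /nbhs_ballP[e /= e0 eP]; exists e => // z /eP.
(* Radial thickening of V past q, small enough to be controlled by [psi]. *)
pose W w := ball p r w /\ exists k : R, [/\ 0 < k, k <= 1 & ball q e (line w k)].
(* [g] and [psi] both lift the segment from [line w k] to [w], which stays in [V] and in the ball
   about [p]. They agree at [line w k], where [g] takes values near [x]. *)
have g_psi w : V w -> W w -> g w = psi w.
  move=> Vw [wr [k [k0 k1 kq]]]; have [Vz zr zd] := qe _ kq.
  have [_ _ Vline] := VP _ Vw.
  pose c (th : R) := line w (k + th * (1 - k)).
  have c_cont : continuous c.
    move=> th; apply: (@continuous_comp _ _ _ (fun th : R => k + th * (1 - k)) (line w));
      last exact: line_cont.
    by apply: cvgD; [exact: cvg_cst|apply: cvgMl; exact: cvg_id].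
  have cV th : 0 <= th -> th <= 1 -> V (c th).
    by move=> th0 th1; apply: Vline; nra.
  have cr th : 0 <= th -> th <= 1 -> ball p r (c th).
    by move=> th0 th1; rewrite /c line_between; exact: ball_segment.
  have c1 : c 1 = w by rewrite /c mul1r addrC subrK line1.
  have c0 : c 0 = line w k by rewrite /c mul0r addr0.
  rewrite -c1.
  apply: (lift_unique f (g \o c) (psi \o c) f_inj) => [th h0 h1|th h0 h1|th h0 h1|] /=.
  - by apply: continuous_comp; [exact: c_cont|have [] := VP _ (cV th h0 h1)].
  - by apply: continuous_comp; [exact: c_cont|exact: psi_cont (cr th h0 h1)].
  - by have [-> _ _] := VP _ (cV th h0 h1); rewrite fpsi//; exact: cr.
  - have [fgz _ _] := VP _ Vz.
    by rewrite c0 -[in RHS]fgz psi_f// fgz.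
have W_open : open W.
  rewrite openE => w [wr [k [k0 k1 kq]]].
  have line_k : {for w, continuous (fun w => line w k)}.
    apply: cvgD; first exact: cvg_cst.
    by apply: cvgZl_tmp; apply: cvgB; [exact: cvg_id|exact: cvg_cst].
  near=> w'; split.
    by near: w'; apply: open_nbhs_nbhs; split=> //; exact: ball_open.
  exists k; split=> //; near: w'; apply: line_k.
  by apply: open_nbhs_nbhs; split=> //; exact: ball_open.
pose g' w := if pselect (V w) then g w else psi w.
have g'V w : V w -> g' w = g w by rewrite /g'; case: pselect.
have g'W w : W w -> g' w = psi w.
  by rewrite /g'; case: pselect => // Vw Ww; exact: g_psi.
have Wp : W p.
  split; first exact: ballxx.
  (* This ratio brings [p] back exactly to [q]. *)
  exists (tau n / t); have [h1 h2] := tauP n; split.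
  - by rewrite divr_gt0.
  - by rewrite ler_pdivrMr// mul1r ltW.
  - by rewrite line_line divfK ?gt_eqF//; exact: ballxx.
exists (V `|` W), g'; split; [|by left|by right].
split; [exact: openU|by left|by rewrite g'V|].
move=> w [Vw|Ww].
  have [fgw gw_cont Vline] := VP _ Vw; split.
  - by rewrite g'V.
  - rewrite /prop_for /continuous_at g'V//.
    apply: cvg_trans gw_cont; apply: near_eq_cvg.
    by apply: filterS (open_nbhs_nbhs (conj V_open Vw)) => z /g'V.
  - by move=> s s0 s1; left; exact: Vline.
have [wr [k [k0 k1 kq]]] := Ww; split.
- by rewrite g'W// fpsi.
- rewrite /prop_for /continuous_at g'W//.
  apply: cvg_trans (psi_cont _ wr); apply: near_eq_cvg.
  by apply: filterS (open_nbhs_nbhs (conj W_open Ww)) => z /g'W.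
(* Up to parameter [k] the segment lies in [V], by star-shapedness at [line w k]; beyond [k] it lies
   in [W], with [k / s] as witness. *)
- move=> s s0 s1; have [Vz zr _] := qe _ kq.
  have [sk|ks] := leP s k.
    left; have [_ _ /(_ (s / k))] := VP _ Vz.
    rewrite line_line divfK ?gt_eqF//; apply; first by rewrite divr_ge0// ltW.
    by rewrite ler_pdivrMr// mul1r.
  have s_gt0 : 0 < s := lt_trans k0 ks.
  right; split.
    have k1' : 0 < 1 - k by rewrite subr_gt0 (lt_le_trans ks).
    have -> : s = k + (s - k) / (1 - k) * (1 - k) by rewrite divfK ?gt_eqF// addrC subrK.
    rewrite line_between; apply: ball_segment => //.
      by rewrite divr_ge0// ltW// subr_gt0.
    by rewrite ler_pdivrMr// mul1r lerD2r.
  exists (k / s); split; first by rewrite divr_gt0.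
    by rewrite ler_pdivrMr// mul1r ltW.
  by rewrite line_line divfK ?gt_eqF.
Unshelve. all: by end_near. Qed.

Lemma proper_local_homeo_inverse :
  exists g : Y -> X, [/\ cancel f g, cancel g f & continuous g].
Proof.
have [V [g [sVg V_max]]] := maximal_section.
have [V_open Va ga VP] := sVg.
have VT y : V y.
  rewrite -(line1 y); apply: (unit_interval_ind (fun t => V (line y t))).
  - by rewrite line0.
  - move=> t t0 _ ih; have [V' [g' [s' _ V't]]] := section_extend _ _ _ _ sVg t0 ih.
    exact: V_max s' _ V't.
  - move=> t t0 t1 Vt; near=> s => _; near: s.
    by apply: line_cont; exact: open_nbhs_nbhs.
have fg : cancel g f by move=> y; have [] := VP y (VT y).
have g_cont : continuous g by move=> y; have [] := VP y (VT y).
exists g; split=> // x.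
(* [c] and [g \o f \o c] are two lifts of the same path with the same origin. *)
pose c (t : R) := a + t *: (x - a).
have c_cont : continuous c.
  by move=> t; apply: cvgD; [exact: cvg_cst|apply: cvgZr_tmp; exact: cvg_id].
have c0 : c 0 = a by rewrite /c scale0r addr0.
have c1 : c 1 = x by rewrite /c scale1r addrC subrK.
rewrite -[in RHS]c1 -[in LHS]c1.
apply: (lift_unique f (g \o f \o c) c f_inj) => [t _ _|t _ _|t _ _|] /=.
- apply: continuous_comp; first exact: c_cont.
  by apply: continuous_comp; [exact: f_cont|exact: g_cont].
- exact: c_cont.
- by rewrite fg.
- by rewrite c0 ga.
Unshelve. all: by end_near. Qed.

End star_section.

(** * Smoothness of the inverse *)

(** The differential of [g] at [y] is the inverse of ['d f (g y)]. Its continuity comes from the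
    identity A - B = B (B^-1 - A^-1) A for two such inverses. *)
Lemma C1_map_inverse {R : realType} {X Y : completeNormedModType R}
    (f : X -> Y) (g : Y -> X) :
  local_C1_diffeo f -> cancel f g -> cancel g f -> continuous g -> C1_map g.
Proof.
move=> [fC1 f_bij] fK gK g_cont.
have g_diff y : differentiable g y /\
    exists2 C : R, 0 < C & [/\ forall v, `|v| <= C * `|'d f (g y) v|,
      forall v, 'd g y ('d f (g y) v) = v & forall w, 'd f (g y) ('d g y w) = w].
  set x := g y; have f_diff := fC1.1 x.
  have [C C0 TC] := bounded_inverse _ (diff_continuous f_diff) (f_bij x).
  have [S TS ST] := f_bij x.
  have S_lin : linear S.
    by move=> s u v; apply: (can_inj TS); rewrite ST linearP !ST.
  pose S' : {linear Y -> X} := HB.pack S (GRing.isLinear.Build _ _ _ _ _ S_lin).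
  have SC w : `|S w| <= C * `|w| by apply: le_trans (TC _) _; rewrite ST.
  have [|g_diff g_val] := near_differentiable g y S' (bound_continuous_linear S' _ SC).
    (* The first bound absorbs half of [|g y' - x|], which makes [g] Lipschitz at [y] with constant
       [2 * C]; the second turns the remainder into at most [e |y' - y|]. *)
    move=> e e0; pose k := Num.min (2 * C)^-1 (e / (2 * C ^+ 2)).
    have k0 : 0 < k by rewrite lt_min invr_gt0 divr_gt0// mulr_gt0// exprn_gt0.
    have Ck : C * k <= 2^-1.
      by rewrite -ler_pdivlMl// -invfM (mulrC C) ge_min lexx.
    have Ck2 : 2 * C * (C * k) <= e.
      have -> : 2 * C * (C * k) = 2 * C ^+ 2 * k by ring.
      rewrite -ler_pdivlMl ?mulr_gt0 ?exprn_gt0//.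
      by rewrite mulrC ge_min lexx orbT.
    have := g_cont y _ (differentiable_near f x k f_diff k0).
    rewrite !near_simpl; apply: filterS => y' /=; rewrite !gK -/x => h.
    have h1 := SC (y' - y - 'd f x (g y' - x)).
    have h2 := ler_wpM2l (ltW C0) h.
    have SB : S (y' - y - 'd f x (g y' - x)) = S (y' - y) - (g y' - x).
      by have /= := linearB S' (y' - y) ('d f x (g y' - x)); rewrite TS.
    rewrite SB in h1; rewrite distrC.
    have h3 := SC (y' - y).
    have h4 := ler_normB (S (y' - y)) (S (y' - y) - (g y' - x)).
    rewrite opprB addrC subrK in h4.
    have h5 := ler_wpM2r (normr_ge0 (g y' - x)) Ck.
    have h6 : `|g y' - x| <= 2 * C * `|y' - y| by lra.
    have h7 := ler_wpM2l (mulr_ge0 (ltW C0) (ltW k0)) h6.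
    have h8 := ler_wpM2r (normr_ge0 (y' - y)) Ck2.
    by lra.
  split=> //; exists C => //; split=> // u; rewrite g_val; [exact: TS|exact: ST].
split=> [y|y0]; first by have [] := g_diff y.
have [_ [C C0 [TC gf fg]]] := g_diff y0.
(* As before, but with [e / 2] as target, because a strict bound is needed at the end. *)
apply/cvgrPdist_lt => e e0; pose k := Num.min (2 * C)^-1 (e / (4 * C ^+ 2)).
have k0 : 0 < k by rewrite lt_min invr_gt0 divr_gt0// mulr_gt0// exprn_gt0.
have Ck : C * k <= 2^-1.
  by rewrite -ler_pdivlMl// -invfM (mulrC C) ge_min lexx.
have Ck2 : 2 * C * (C * k) <= e / 2.
  have -> : 2 * C * (C * k) = (4 * C ^+ 2) * k / 2 by field.
  rewrite ler_pM2r ?invr_gt0// -ler_pdivlMl ?mulr_gt0 ?exprn_gt0//.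
  by rewrite mulrC ge_min lexx orbT.
have := g_cont y0 _ (C1_map_near f (g y0) k fC1 k0).
rewrite !near_simpl; apply: filterS => y /= h.
rewrite sub0r normrN ger0_norm ?opnorm_ge0//.
apply: (@le_lt_trans _ _ (e / 2)); last by rewrite ltr_pdivrMr// ltr_pMr// ltr1n.
apply: opnorm_le => w w1.
have [_ [_ _ [_ _ fg']]] := g_diff y.
have h1 := h ('d g y w); rewrite fg' in h1.
have h2 := TC ('d g y w - 'd g y0 w).
rewrite linearB /= fg [X in _ <= C * X]distrC in h2.
have h3 := ler_wpM2l (ltW C0) h1.
have h4 := TC ('d g y0 w); rewrite fg in h4.
have h5 := ler_normD ('d g y w - 'd g y0 w) ('d g y0 w); rewrite subrK in h5.
have h6 := ler_wpM2r (normr_ge0 ('d g y w)) Ck.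
have h7 := ler_wpM2l (ltW C0) w1.
have h8 : `|'d g y w| <= 2 * C by lra.
have h9 := ler_wpM2l (mulr_ge0 (ltW C0) (ltW k0)) h8.
by lra.
Qed.

(** * Coercivity and properness from the weighted Palais-Smale condition *)

(** [H r] is the integral of 1/(1+h) over [0, r]. The integrand is nonincreasing, so its value at
    the left endpoint bounds the increments. *)
Lemma weight_primitive {R : realType} (h : R -> R) :
    (forall r, 0 <= r -> 0 <= h r) ->
    {within `[0, +oo[, continuous h} ->
    (forall r s, 0 <= r -> r <= s -> h r <= h s) ->
    (\int[lebesgue_measure]_(rho in `[0%R, +oo[) ((1 + h rho)^-1)%:E)%E = +oo%E ->
  exists H : R -> R, [/\ forall a b, 0 <= a -> a <= b -> H a <= H b,
    forall a b, 0 <= a -> a <= b -> H b - H a <= (1 + h a)^-1 * (b - a) &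
    forall M, exists2 r, 0 <= r & M < H r].
Proof.
move=> h_ge0 h_cont h_mono h_int.
pose w (r : R) := (1 + h r)^-1.
have h1 r : 0 <= r -> 0 < 1 + h r by move=> r0; rewrite ltr_wpDr// h_ge0.
have w0 r : 0 <= r -> 0 <= w r by move=> r0; rewrite invr_ge0 ltW// h1.
have w_le a r : 0 <= a -> a <= r -> w r <= w a.
  move=> a0 ar; rewrite lef_pV2 ?posrE ?h1 ?lerD2l ?h_mono//.
  exact: le_trans ar.
have w_meas : measurable_fun `[(0 : R), +oo[ (EFin \o w).
  apply/measurable_EFinP.
  (* The absolute value keeps the denominator positive even where the sign of [h] is unknown. *)
  apply: (eq_measurable_fun (fun r => (1 + `|h r|)^-1)).
    by move=> r; rewrite inE/= in_itv/= andbT => r0; rewrite ger0_norm ?h_ge0.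
  apply: subspace_continuous_measurable_fun => //.
  move=> r; apply: cvgV; first by rewrite gt_eqF// ltr_wpDr.
  by apply: cvgD; [exact: cvg_cst|apply: cvg_norm; exact: h_cont].
pose I (i : interval R) := (\int[lebesgue_measure]_(r in [set` i]) (w r)%:E)%E.
have I_split a b : 0 <= a -> a <= b ->
    I `[0%R, b] = (I `[0%R, a] + I `]a, b])%E.
  move=> a0 ab; rewrite /I -ge0_integral_setU//=.
  - congr (integral _ _ _); apply/seteqP; split => r /=; rewrite !in_itv/=.
      by move=> /andP[r0 rb]; have [ra|ar] := leP r a; [left; rewrite r0|right].
    by case=> /andP[r0 rb]; [rewrite r0 (le_trans rb)|rewrite (le_trans a0 (ltW r0))].
  - apply: measurable_funS w_meas => //.
    move=> r /= [|] /andP[]; rewrite !in_itv/= ?andbT// => /ltW ar _.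
    exact: le_trans ar.
  - move=> r [|] /=; rewrite in_itv/= => /andP[r0 _]; rewrite lee_fin w0//.
    exact: le_trans a0 (ltW r0).
  - apply/disj_setPS => r [] /=; rewrite !in_itv/= => /andP[_ ra] /andP[ar _].
    by move: ar; rewrite ltNge ra.
have I_ge0 a b : 0 <= a -> (0 <= I `]a, b])%E.
  move=> a0; apply: integral_ge0 => r /=; rewrite in_itv/= => /andP[ar _].
  by rewrite lee_fin w0// (le_trans a0 (ltW ar)).
have I_le a b : 0 <= a -> a <= b -> (I `]a, b] <= (w a * (b - a))%:E)%E.
  move=> a0 ab.
  have : (I `]a, b] <= \int[lebesgue_measure]_(r in `]a, b]) (cst (w a)%:E) r)%E.
    apply: ge0_le_integral => //=.
    - move=> r /=; rewrite in_itv/= => /andP[ar _].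
      by rewrite lee_fin w0// (le_trans a0 (ltW ar)).
    - apply: measurable_funS w_meas => //.
      by move=> r /=; rewrite !in_itv/= andbT => /andP[/ltW ar _]; exact: le_trans ar.
    - move=> r /=; rewrite in_itv/= => /andP[ar _].
      by rewrite lee_fin w_le// ltW.
  move/le_trans; apply; rewrite integral_cst//= lebesgue_measure_itv/= lte_fin.
  case: ifPn => [_|]; first by rewrite -EFinB -EFinM.
  by rewrite mule0 lee_fin mulr_ge0 ?w0 ?subr_ge0.
have I_fin b : 0 <= b -> I `[0%R, b] \is a fin_num.
  move=> b0.
  have I0 : I `[0%R, 0] = 0%E by rewrite /I set_itv1 integral_set1.
  rewrite (I_split 0 b)// I0 add0e ge0_fin_numE ?I_ge0//.
  exact: le_lt_trans (I_le 0 b (lexx _) b0) (ltry _).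
have I_fin' a b : 0 <= a -> a <= b -> I `]a, b] \is a fin_num.
  by move=> a0 ab; rewrite ge0_fin_numE ?I_ge0// (le_lt_trans (I_le a b a0 ab)) ?ltry.
have H_split a b : 0 <= a -> a <= b ->
    fine (I `[0%R, b]) = fine (I `[0%R, a]) + fine (I `]a, b]).
  by move=> a0 ab; rewrite (I_split a b)// fineD// ?I_fin ?I_fin'.
exists (fun r => fine (I `[0%R, r])); split.
- move=> a b a0 ab; rewrite (H_split a b)// lerDl fine_ge0//; exact: I_ge0.
- move=> a b a0 ab; rewrite (H_split a b)// addrC addKr -lee_fin fineK ?I_fin'//.
  exact: I_le.
- move=> M; apply: contrapT => HM.
  have I_M r : 0 <= r -> (I `[0%R, r] <= M%:E)%E.
    move=> r0; rewrite -(fineK (I_fin _ r0)) lee_fin leNgt; apply/negP => Mr.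
    by apply: HM; exists r.
  (* Monotone convergence over the intervals [0, n]. *)
  have : (I `[0%R, +oo[ <= M%:E)%E.
    pose D (n : nat) : set R := [set` `[0, 0 + n%:R]].
    have D_ge0 n r : D n r -> 0 <= r by rewrite /D/= in_itv/= => /andP[].
    have D_mono : {homo D : n m / (n <= m)%N >-> (n <= m)%O}.
      move=> n m nm; apply/subsetPset => r; rewrite /D/= !in_itv/= => /andP[-> rn].
      by apply: le_trans rn _; rewrite lerD2l ler_nat.
    have D_meas n : measurable_fun (D n) (EFin \o w).
      apply: measurable_funS w_meas => // r /D_ge0 r0.
      by rewrite /= in_itv/= r0.
    have D_w n r : D n r -> (0 <= (EFin \o w) r)%E.
      by move=> /D_ge0 r0; rewrite lee_fin w0.
    have I_cvg := @ge0_nondecreasing_set_cvg_integral _ (measurableTypeR R) R D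
      (EFin \o w) lebesgue_measure D_mono (fun=> measurable_itv _) D_meas D_w.
    rewrite /I itv_bndy_bigcup_BRight -(cvg_lim _ I_cvg)//.
    apply: lime_le; first exact: cvgP I_cvg.
    by apply: nearW => n; apply: I_M; rewrite add0r.
  by rewrite /I h_int.
Qed.

(** The increment bound uses the weight at the smaller norm, which may be that of [x]; the factor 2
    covers the variation of [h] near [z]. *)
Lemma near_lipschitz_weight {R : realType} {X : normedModType R} (h H : R -> R)
    (z : X) :
  (forall r, 0 <= r -> 0 <= h r) ->
  {within `[0, +oo[, continuous h} ->
  (forall a b, 0 <= a -> a <= b -> H a <= H b) ->
  (forall a b, 0 <= a -> a <= b -> H b - H a <= (1 + h a)^-1 * (b - a)) ->
  \forall x \near z,
    `|H `|x| - H `|z| | <= 2 * (1 + h `|z|)^-1 * `|x - z|.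
Proof.
move=> h_ge0 h_cont H_mono H_lip.
have h1 r : 0 <= r -> 0 < 1 + h r by move=> r0; rewrite ltr_wpDr// h_ge0.
have hz : \forall x \near z, 1 + h `|z| < 2 * (1 + h `|x|).
  have hz_cvg : h `|x| @[x --> z] --> h `|z|.
    move=> P hP; have z0 : [set` `[(0 : R), +oo[] `|z| by rewrite /= in_itv/= normr_ge0.
    have := @norm_continuous _ _ z _ ((subspace_continuousP _ _).1 h_cont _ z0 _ hP).
    rewrite !near_simpl; apply: filterS => x /=; apply.
    by rewrite in_itv/= normr_ge0.
  have hz0 : (h `|z| - 1) / 2 < h `|z| by have := h_ge0 _ (normr_ge0 z); lra.
  by apply: filterS (cvgr_gt _ hz_cvg _ hz0) => x /=; lra.
near=> x.
have hx : 1 + h `|z| < 2 * (1 + h `|x|) by near: x.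
have wx : (1 + h `|x|)^-1 <= 2 * (1 + h `|z|)^-1.
  by rewrite ler_pdivlMr ?h1// ler_pdivrMl ?h1// mulrC ltW.
have wz : 0 < (1 + h `|z|)^-1 by rewrite invr_gt0 h1.
have xz1 := le_trans (ler_norm _) (ler_dist_dist z x).
have xz2 := le_trans (ler_norm _) (ler_dist_dist x z).
have [xz_le|/ltW zx_le] := leP `|x| `|z|.
  have h2 := H_lip _ _ (normr_ge0 x) xz_le.
  have h3 := H_mono _ _ (normr_ge0 x) xz_le.
  rewrite distrC ger0_norm ?subr_ge0//; apply: le_trans h2 _.
  apply: ler_pM => //; last by rewrite distrC.
    by rewrite invr_ge0 ltW// h1.
  by rewrite subr_ge0.
have h2 := H_lip _ _ (normr_ge0 z) zx_le.
have h3 := H_mono _ _ (normr_ge0 z) zx_le.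
rewrite ger0_norm ?subr_ge0//; apply: le_trans h2 _.
by apply: ler_pM => //; rewrite ?subr_ge0// ?(ltW wz)//; lra.
Unshelve. all: by end_near. Qed.

Lemma half_sqr_dist_continuous {R : realType} {X Y : normedModType R} (f : X -> Y)
    (y : Y) : continuous f -> continuous (fun x => `|f x - y| ^+ 2 / 2).
Proof.
move=> f_cont x; apply: cvgMl.
have fy_cvg : `|f x' - y| @[x' --> x] --> `|f x - y|.
  by apply: cvg_norm; apply: cvgB; [exact: f_cont|exact: cvg_cst].
exact: (cvgM fy_cvg fy_cvg).
Qed.

Section weighted_chang_PS.
Context {R : realType} {X : completeNormedModType R} (h : R -> R).
Hypothesis h_ge0 : forall r, 0 <= r -> 0 <= h r.
Hypothesis h_cont : {within `[0, +oo[, continuous h}.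
Hypothesis h_mono : forall r s, 0 <= r -> r <= s -> h r <= h s.
Hypothesis h_int : (\int[lebesgue_measure]_(rho in `[0%R, +oo[)
  ((1 + h rho)^-1)%:E)%E = +oo%E.

Lemma chang_PS_coercive (F : X -> R) : continuous F -> (forall x, 0 <= F x) ->
  weighted_chang_PS h F -> forall M, exists r, forall x, r < `|x| -> M < F x.
Proof.
move=> F_cont F_ge0 PS M; apply: contrapT => not_coercive.
have [H [H_mono H_lip H_unb]] := weight_primitive h h_ge0 h_cont h_mono h_int.
have far r : exists2 x, r < `|x| & F x <= M.
  apply: contrapT => no_x; apply: not_coercive; exists r => x rx.
  by rewrite ltNge; apply/negP => FxM; apply: no_x; exists x.
have M0 : 0 <= M by have [x _] := far 0; apply: le_trans.
have h1 r : 0 <= r -> 0 < 1 + h r by move=> r0; rewrite ltr_wpDr// h_ge0.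
have H_cont : continuous (fun x : X => H `|x|).
  move=> z; apply/cvgrPdist_lt => e e0.
  have near_H := near_lipschitz_weight h H z h_ge0 h_cont H_mono H_lip.
  have w0 : 0 < 2 * (1 + h `|z|)^-1 by rewrite mulr_gt0// invr_gt0 h1.
  near=> x.
  rewrite distrC; apply: (@le_lt_trans _ _ (2 * (1 + h `|z|)^-1 * `|x - z|)).
    by near: x.
  rewrite -ltr_pdivlMl// distrC; near: x.
  by apply: cvgr_dist_lt; [exact: cvg_id|rewrite mulr_gt0 ?invr_gt0].
(* The 3 is 2 from [near_lipschitz_weight] plus 1 from the Ekeland slope [eta]. *)
have seq n : exists x : X, [/\ n%:R <= `|x|, F x <= M &
    clarke_lambda F x * (1 + h `|x|) <= 3 * n.+1%:R^-1].
  have : 0 < n.+1%:R^-1 :> R by rewrite invr_gt0.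
  move: n.+1%:R^-1 => q q0.
  (* Ekeland's point [z] will satisfy [|H |z| - s| <= M / q]; with [s] this large, [|z|] is at least
     [n]. *)
  have [r r0 Hr] := H_unb (H n%:R + M / q).
  have [x0 x0r Fx0] := far r.
  pose s := H `|x0|.
  have s_ge : H n%:R + M / q < s.
    by apply: lt_le_trans Hr _; apply: H_mono => //; exact: ltW.
  (* [R'] is an a priori upper bound for [|z|], so that [eta] can be fixed before [z] is known. *)
  have [R' R'0 HR'] := H_unb (s + M / q).
  pose G x := F x + q * `|H `|x| - s|.
  pose eta := q * (1 + h R')^-1.
  have eta0 : 0 < eta by rewrite mulr_gt0// invr_gt0 h1.
  have [||z [Gz Gz_min]] := ekeland G eta x0 eta0.
  - move=> x; apply: cvgD; first exact: F_cont.
    apply: cvgMr; apply: cvg_norm; apply: cvgB; [exact: H_cont|exact: cvg_cst].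
  - by move=> x; rewrite addr_ge0// mulr_ge0// ltW.
  have {}Gz : G z <= M.
    apply: le_trans (le_trans _ Gz) _; first by rewrite lerDl mulr_ge0// ltW.
    by rewrite /G subrr normr0 mulr0 addr0.
  have Fz : F z <= M by apply: le_trans Gz; rewrite lerDl mulr_ge0// ltW.
  have Hz : `|H `|z| - s| <= M / q.
    rewrite ler_pdivlMr//; have := F_ge0 z; rewrite mulrC.
    by move: Gz; rewrite /G; lra.
  have [Hz1 Hz2] : H n%:R < H `|z| /\ H `|z| < H R'.
    by move: Hz; rewrite ler_norml => /andP[]; split; lra.
  have nz : n%:R <= `|z|.
    by rewrite leNgt; apply/negP => /ltW/(H_mono _ _ (normr_ge0 z)); rewrite leNgt Hz1.
  have zR : `|z| <= R'.
    by rewrite leNgt; apply/negP => /ltW/(H_mono _ _ R'0); rewrite leNgt Hz2.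
  exists z; split=> //; rewrite -ler_pdivlMr ?h1//.
  apply: clarke_lambda_le.
    apply: mulr_ge0; last by rewrite invr_ge0 ltW// h1.
    by rewrite mulr_ge0// ltW.
  have eta_le : eta <= q * (1 + h `|z|)^-1.
    by rewrite ler_pM2l// lef_pV2 ?posrE ?h1// lerD2l h_mono.
  near=> x.
  have h2 : `|H `|x| - H `|z| | <= 2 * (1 + h `|z|)^-1 * `|x - z|.
    by near: x; exact: near_lipschitz_weight.
  have h3 := Gz_min x; rewrite /G in h3.
  have h4 := ler_distD (H `|z|) (H `|x|) s.
  have h5 : q * `|H `|x| - s| <=
      q * (2 * (1 + h `|z|)^-1 * `|x - z| + `|H `|z| - s|).
    by rewrite ler_pM2l//; lra.
  have h6 := ler_wpM2r (normr_ge0 (x - z)) eta_le.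
  by lra.
have /choice[u uP] := seq.
have [||phi phi_incr /cvg_ex[l ul]] := PS u.
- by exists M => n; have [_ un _] := uP n; rewrite ger0_norm.
- apply: (@squeeze_cvgr _ _ _ _ (fun=> 0) (fun n => 3 * n.+1%:R^-1)).
  + apply: nearW => n; have [_ _ ->] := uP n; rewrite andbT mulr_ge0//.
      exact: clarke_lambda_ge0.
    by rewrite ltW// h1.
  + exact: cvg_cst.
  + rewrite -[X in _ --> X](mulr0 3); apply: cvgMr; exact: cvg_harmonic.
have phi_ge := homo_ltn_leq _ phi_incr.
have : \forall n \near \oo, `|u (phi n)| < `|l| + 1.
  have : `|u (phi n)| @[n --> \oo] --> `|l| by exact: cvg_norm.
  by move=> /cvgr_lt; apply; rewrite ltrDl.
have : \forall n \near \oo, `|l| + 1 <= n%:R by exact: nbhs_infty_ger.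
move=> near1 near2; near \oo => n.
have un : `|u (phi n)| < `|l| + 1 by near: n.
have ln : `|l| + 1 <= n%:R by near: n.
have [nu _ _] := uP (phi n).
have : n%:R <= (phi n)%:R :> R by rewrite ler_nat.
by lra.
Unshelve. all: by end_near. Qed.

(** Ekeland's principle replaces [u n] by a point [z n] at distance at most [e n] with
    [clarke_lambda] at most [e n]. The Palais-Smale condition applies to [z], and [u] has the same
    subsequential limits. *)
Lemma chang_PS_proper {Y : normedModType R} (f : X -> Y) (u : nat -> X) (y : Y) :
  continuous f ->
  (forall y, weighted_chang_PS h (fun x => `|f x - y| ^+ 2 / 2)) ->
  f (u n) @[n --> \oo] --> y ->
  exists2 phi : nat -> nat, {homo phi : m n / (m < n)%N} & cvgn (u \o phi).
Proof.
move=> f_cont PS f_cvg; pose F x := `|f x - y| ^+ 2 / 2.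
have F_ge0 x : 0 <= F x by rewrite divr_ge0// exprn_ge0.
have F_cont : continuous F by exact: half_sqr_dist_continuous.
(* The harmonic term keeps [e n] positive when [f (u n) = y]. *)
pose e n : R := `|f (u n) - y| + n.+1%:R^-1.
have e_gt0 n : 0 < e n by rewrite ltr_wpDl// invr_gt0.
have e_cvg : e n @[n --> \oo] --> (0 : R).
  rewrite -[X in _ --> X](addr0 0); apply: cvgD; last exact: cvg_harmonic.
  have -> : (0 : R) = `|y - y| by rewrite subrr normr0.
  by apply: cvg_norm; apply: cvgB => //; exact: cvg_cst.
have F_le n : F (u n) <= e n ^+ 2.
  have sqr_le (a q : R) : 0 <= a -> 0 <= q -> a ^+ 2 / 2 <= (a + q) ^+ 2 by nra.
  by apply: sqr_le; rewrite ?invr_ge0.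
have ek n : exists z, [/\ `|z - u n| <= e n, F z <= F (u n) &
    clarke_lambda F z <= e n].
  have [z [Fz Fz_min]] := ekeland F (e n) (u n) (e_gt0 n) F_cont F_ge0.
  exists z; split.
  - rewrite -(ler_pM2l (e_gt0 n)) -expr2; apply: le_trans (F_le n).
    by apply: le_trans Fz; rewrite lerDr.
  - by apply: le_trans Fz; rewrite lerDl mulr_ge0// ltW.
  - by apply: clarke_lambda_le; [exact: ltW|exact: nearW].
have /choice[z zP] := ek.
have [B FB] : exists B, forall n, F (u n) <= B.
  have /cvg_seq_bounded : cvgn e by exact: cvgP e_cvg.
  move=> /pinfty_ex_gt0[B B0 eB]; exists (B ^+ 2) => n; apply: le_trans (F_le n) _.
  rewrite lerXn2r ?nnegrE ?(ltW B0) ?(ltW (e_gt0 n))//.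
  by apply: le_trans (eB n Logic.I); rewrite ger0_norm// ltW.
have FzB n : F (z n) <= B by have [_ h1 _] := zP n; apply: le_trans h1 _.
(* Coercivity bounds [|z n|], hence the weight [1 + h |z n|]. *)
have [r r_coercive] := chang_PS_coercive F F_cont F_ge0 (PS y) B.
have z_le n : `|z n| <= r.
  by rewrite leNgt; apply/negP => /r_coercive; rewrite ltNge FzB.
have r0 : 0 <= r := le_trans (normr_ge0 (z 0%N)) (z_le 0%N).
have h1 s : 0 <= s -> 0 < 1 + h s by move=> s0; rewrite ltr_wpDr// h_ge0.
have [||phi phi_incr /cvg_ex[l zl]] := PS y z.
- by exists B => n; rewrite ger0_norm//; exact: FzB.
- apply: (@squeeze_cvgr _ _ _ _ (fun=> 0) (fun n => e n * (1 + h r))).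
  + apply: nearW => n; apply/andP; split.
      by rewrite mulr_ge0 ?clarke_lambda_ge0// ltW// h1.
    have [_ _ le_e] := zP n; apply: ler_pM => //.
    * exact: clarke_lambda_ge0.
    * by rewrite ltW// h1.
    * by rewrite lerD2l h_mono.
  + exact: cvg_cst.
  + by rewrite -[X in _ --> X](mul0r (1 + h r)); apply: cvgMl.
exists phi => //; apply/cvg_ex; exists l.
have phi_cvg := homo_ltn_cvg _ phi_incr.
have zu : z (phi n) - u (phi n) @[n --> \oo] --> (0 : X).
  apply/norm_cvg0P.
  apply: (@squeeze_cvgr _ _ _ _ (fun=> 0) (fun n => e (phi n))).
  + by apply: nearW => n; have [h2 _ _] := zP (phi n); rewrite normr_ge0.
  + exact: cvg_cst.
  + exact: (cvg_comp _ _ phi_cvg e_cvg).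
have -> : u \o phi = (fun n => z (phi n) - (z (phi n) - u (phi n))).
  by apply/funext => n; rewrite opprB addrC subrK.
by rewrite -[l]subr0; apply: cvgB.
Qed.

End weighted_chang_PS.

Theorem corollary3 (R : realType) (X Y : completeNormedModType R)
    (f : X -> Y) (h : R -> R)
    (hf : local_C1_diffeo f)
    (* h is a function from [0, +oo[ to [0, +oo[; its values elsewhere are
       irrelevant *)
    (h_ge0 : forall r, 0 <= r -> 0 <= h r)
    (h_cont : {within `[0, +oo[, continuous h})
    (h_mono : forall r s, 0 <= r -> r <= s -> h r <= h s)
    (h_int : (\int[lebesgue_measure]_(rho in `[0%R, +oo[)
                ((1 + h rho)^-1)%:E)%E = +oo%E)
    (hPS : forall y : Y,
      weighted_chang_PS h (fun x => `|f x - y| ^+ 2 / 2)) :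
  global_C1_diffeo f /\ norm_coercive f.
Proof.
have f_cont := C1_map_continuous f hf.1.
have f_local x := local_C1_diffeo_inverse f x hf.
have f_proper u y := chang_PS_proper h h_ge0 h_cont h_mono h_int f u y f_cont hPS.
split.
  have [g [fK gK g_cont]] := proper_local_homeo_inverse f 0 f_cont f_local f_proper.
  split; first exact: hf.1.
  by exists g; split=> //; exact: C1_map_inverse fK gK g_cont.
move=> M; pose F x := `|f x - 0| ^+ 2 / 2.
have F_ge0 x : 0 <= F x by rewrite divr_ge0// exprn_ge0.
have F_cont : continuous F by exact: half_sqr_dist_continuous.
(* At level [M ^+ 2], because [|f x| <= M] would give [F x <= M ^+ 2 / 2]. *)
have [r rP] := chang_PS_coercive h h_ge0 h_cont h_mono h_int F F_cont F_ge0
  (hPS 0) (M ^+ 2).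
exists r => x /rP; rewrite /F subr0 => MF; rewrite ltNge; apply/negP => fM.
by have := normr_ge0 (f x); nra.
Qed.
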